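(* Let $n$ be an odd positive integer, let $K$ be a field of characteristic different from $2$ containing a primitive $n$-th root of unity $\omega$, let $a,b\in K^{\times}$, let $S=(a,b;n,K,\omega)$ be the corresponding symbol algebra, and let $T_S$ be its quadratic trace form. Let $k\ge 0$ be an integer. Then $$S^kT_S\simeq\begin{cases}\displaystyle\binom{\frac{n^2+k-2}{2}}{\frac{k-1}{2}}\times\left\langle(-1)^{\frac{n-1}{2}}\right\rangle\perp\mathrm{Hyp},&\text{if }k\text{ is odd};\\[3mm]\displaystyle\binom{\frac{n^2+k-1}{2}}{\frac{k}{2}}\times\langle 1\rangle\perp\mathrm{Hyp},&\text{if }k\text{ is even}.\end{cases}$$ Here $\mathrm{Hyp}$ denotes the orthogonal sum of the number of hyperbolic planes needed for the right-hand side to have dimension $\dim S^kT_S=\binom{n^2+k-1}{k}$.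
   Context: $K$ is a field with $\mathrm{char}(K)\neq 2$, and symmetric bilinear forms over $K$ are identified with quadratic forms. $\langle a_1,\dots,a_m\rangle$ denotes the diagonal form with coefficients $a_i\in K^{\times}$. $\mathbb{H}=\langle 1,-1\rangle$ is the hyperbolic plane. For $r\ge 0$, $r\times\varphi$ denotes the orthogonal sum of $r$ copies of $\varphi$. $\perp$ denotes orthogonal sum and $\simeq$ denotes isometry. (Non-factorial) symmetric power: for $\varphi\simeq\langle a_1,\dots,a_m\rangle$ and an integer $k\ge 0$, the $k$-fold symmetric power $S^k\varphi$ is the diagonal form on the $k$-th symmetric power $S^kV$ of the underlying space $V$ given by the orthogonal sum of the one-dimensional forms $\langle a_{i_1}^{k_{i_1}}\cdots a_{i_\ell}^{k_{i_\ell}}\rangle$ over all choices of indices $1\le i_1<\dots<i_\ell\le m$ and positive integers $k_{i_1},\dots,k_{i_\ell}$ with $k_{i_1}+\dots+k_{i_\ell}=k$. That is, there is one summand for each degree-$k$ monomial in $a_1,\dots,a_m$. In particular $S^0\varphi=\langle 1\rangle$, $S^1\varphi=\varphi$ and $\dim S^k\varphi=\binom{m+k-1}{k}$. Up to isometry $S^k\varphi$ depends only on the isometry class of $\varphi$. Symbol algebra: for $a,b\in K^{\times}$ and a primitive $n$-th root of unity $\omega\in K$, $(a,b;n,K,\omega)$ is the $K$-algebra generated by elements $x,y$ with $x^n=a$, $y^n=b$, $yx=\omega xy$. It is a central simple $K$-algebra of degree $n$ (dimension $n^2$). Trace form: for a central simple $K$-algebra $A$, $T_A\colon A\to K$ is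 the quadratic form $T_A(z)=\mathrm{Trd}_A(z^2)$, where $\mathrm{Trd}_A$ is the reduced trace of $A$. *)

(* Defs.v *)
From HB Require Import structures.
From mathcomp Require Import all_boot all_order all_algebra all_field.
From mathcomp Require Import boolp classical_sets.

Set Implicit Arguments.
Unset Strict Implicit.
Unset Printing Implicit Defensive.

Import GRing.Theory.
Local Open Scope ring_scope.

(* A form on a finite-dimensional space V is represented by its value map
   V -> K. No quadraticity axiom is attached: it is inherited through an
   isometry with a diagonal form. *)

Definition isometric (K : fieldType) (V W : vectType K)
    (q : V -> K) (q' : W -> K) : Prop :=
  exists2 f : {linear V -> W}, bijective f & forall v, q' (f v) = q v.

Definition perp (K : fieldType) (V W : vectType K)
    (q : V -> K) (q' : W -> K) : (V * W)%type -> K :=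
  fun v => q v.1 + q' v.2.

Definition copies (K : fieldType) (V : vectType K) (r : nat) (q : V -> K) :
    {ffun 'I_r -> V} -> K :=
  fun v => \sum_i q (v i).

Arguments copies {K V} r q.

Definition diag_form (K : fieldType) (I : finType) (c : I -> K) :
    {ffun I -> K^o} -> K :=
  fun v => \sum_i c i * v i ^+ 2.

Definition unary_form (K : fieldType) (c : K) := diag_form (tnth [tuple c]).

Definition hyperbolic_plane (K : fieldType) :=
  diag_form (tnth [tuple (1 : K); -1]).

Arguments unary_form {K} c.
Arguments hyperbolic_plane K : clear implicits.

(* Exponent vectors of the monomials of degree k in m variables. *)
Definition monomial (m k : nat) : finType :=
  {e : {ffun 'I_m -> 'I_k.+1} | (\sum_i e i == k)%N}.

Definition diag_sym_power (K : fieldType) (m k : nat) (c : 'I_m -> K) :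
    {ffun monomial m k -> K^o} -> K :=
  diag_form (fun e : monomial m k => \prod_i c i ^+ val e i).

Arguments diag_sym_power {K m} k c.

Definition diagonalizes (K : fieldType) (V : vectType K) (q : V -> K)
    (c : {ffun 'I_(\dim {:V}) -> K}) : Prop :=
  (forall i, c i != 0) /\ isometric q (diag_form c).

(* The diagonalization of q is picked by choice; the default value 0 is only
   reached when q has none with nonzero coefficients. *)
Definition sym_power (K : fieldType) (V : vectType K) (k : nat) (q : V -> K) :=
  diag_sym_power k (xget [ffun=> 0] [set c | diagonalizes q c]%classic).

Arguments sym_power {K V} k q.

(* phi is the restriction to A of an isomorphism of L-algebras from A (x)_K L
   to 'M[L]_d, where L is a K-algebra through iota: such a phi is a ring
   morphism, semilinear along iota, that sends a K-basis of A to an L-basis. *)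
Definition splitting (K : fieldType) (A : falgType K) (L : fieldType)
    (iota : {rmorphism K -> L}) (d : nat) (phi : {rmorphism A -> 'M[L]_d}) :
    Prop :=
  (forall (c : K) (z : A), phi (c *: z) = iota c *: phi z) /\
  basis_of fullv [seq phi z | z <- vbasis {:A}].

Definition is_reduced_trace (K : fieldType) (A : falgType K) (z : A) (t : K) :
    Prop :=
  exists (L : fieldType) (iota : {rmorphism K -> L}) (d : nat)
         (phi : {rmorphism A -> 'M[L]_d}),
    splitting iota phi /\ iota t = \tr (phi z).

(* For A central simple, exactly one t satisfies is_reduced_trace z t. *)
Definition reduced_trace (K : fieldType) (A : falgType K) (z : A) : K :=
  xget 0 [set t | is_reduced_trace z t]%classic.

Definition trace_form (K : fieldType) (A : falgType K) : A -> K :=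
  fun z => reduced_trace (z ^+ 2).

Arguments trace_form {K} A.

(* For a primitive n-th root of unity omega and nonzero a, b, the algebra
   presented by these generators and relations is simple, of dimension n ^ 2.
   As an falgType is nontrivial, any falgType satisfying this predicate is
   therefore isomorphic to it. *)
Definition is_symbol_algebra (K : fieldType) (n : nat) (omega a b : K)
    (S : falgType K) : Prop :=
  exists x y : S,
    [/\ x ^+ n = a%:A, y ^+ n = b%:A, y * x = omega *: (x * y)
      & <<<<[:: x; y]>>%VS>>%AS = fullv :> {vspace S}].

(* Main.v *)
From HB Require Import structures.
Require Import Defs.
From mathcomp Require Import all_boot all_order all_algebra all_field.
From mathcomp Require boolp classical_sets.
From mathcomp Require Import zify ring.

Set Implicit Arguments.
Unset Strict Implicit.
Unset Printing Implicit Defensive.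

Import GRing.Theory.
Local Open Scope ring_scope.

(** The trace form of S is diagonal up to hyperbolic planes. In the basis of
    monomials x^i y^j with 0 <= i, j < n the reduced trace of a product of two
    monomials vanishes unless their exponents are opposite modulo n, so T_S
    pairs each monomial with its opposite. As n is odd, only the monomial 1 is
    its own opposite; it contributes <n>, and every other pair spans a
    hyperbolic plane. Moreover n is (-1)^((n-1)/2) times a square, because
    n is the product of the 1 - omega^i for 0 < i < n, in which the factor of
    index n - i is - omega^(-i) times that of index i, and omega is a square
    as n is odd.
    Hence T_S is isometric to the form with coefficients d = (-1)^((n-1)/2)
    once and 1, -1 each (n^2-1)/2 times ([isometric_trace_form]).

    The symmetric power is defined from some diagonalization of T_S, so one
    needs that S^k does not depend on it. By Witt's chain equivalence theorem
    ([chain_isometric]), two diagonalizations of a form are connected by moves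
    that permute the coefficients, multiply one of them by a square or change
    two of them inside a binary form. That S^k respects these moves is read on
    generating series: modulo squares 1/(1 - a t) is (1 + a t)/(1 - t^2), so
    a binary form <a, b> enters only through 1 + <a, b> t + <ab> t^2, that is,
    through its isometry class ([chain_symseq]).

    All the coefficients of the symmetric power of <d, 1, -1, ..., 1, -1> are
    1 or -1, hence it is determined by its dimension and by the sum of these
    coefficients in the integers. With p = (n^2-1)/2 that sum is the
    coefficient of t^k in 1/((1 - d t)(1 - t^2)^p), which is d^k times the
    binomial coefficient of p + floor(k/2) over floor(k/2)
    ([sum_symseq_signs]).

    The reduced trace is computed in an arbitrary splitting: conjugation by
    the images of x and y multiplies the monomials by powers of omega, so all
    of them but 1 have trace zero ([mxtrace_splitting]). A splitting exists
    over any extension of K in which a has an n-th root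
    ([symbol_splitting]). *)

(** * Symmetric powers of diagonal forms and chain equivalence *)

(** The coefficients of the symmetric power: the values at s of all monomials
    of degree k, listed by whether the first variable occurs. The recursion
    is the identity (1 - x t) H_(x :: s)(t) = H_s(t) between generating
    series. *)
Fixpoint symseq (R : pzRingType) (s : seq R) : nat -> seq R :=
  if s is x :: s' then
    fix symseq_x k :=
      if k is k'.+1 then symseq s' k'.+1 ++ [seq x * y | y <- symseq_x k']
      else symseq s' 0
  else fun k => nseq (k == 0) 1.

Lemma symseq0 (R : pzRingType) (s : seq R) : symseq s 0 = [:: 1].
Proof. by elim: s. Qed.

Lemma symseqS (R : pzRingType) x (s : seq R) k :
  symseq (x :: s) k.+1 =
    symseq s k.+1 ++ [seq x * y | y <- symseq (x :: s) k].
Proof. by []. Qed.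

Lemma map_symseq (R R' : pzRingType) (f : {rmorphism R -> R'}) s k :
  [seq f x | x <- symseq s k] = symseq (map f s) k.
Proof.
elim: s k => [|x s IHs] k; first by rewrite /= map_nseq rmorph1.
elim: k => [|k IHk]; first by rewrite !symseq0 /= rmorph1.
rewrite map_cons 2!symseqS -map_cons -IHk -IHs map_cat -!map_comp.
congr (_ ++ _).
by apply: eq_map => y /=; rewrite rmorphM.
Qed.

Lemma size_symseq (R : pzRingType) (s : seq R) k :
  size (symseq s k) = 'C(size s + k - 1, k).
Proof.
elim: s k => [|x s IHs] k.
  by rewrite size_nseq; case: k => [|k] //=; rewrite add0n subn1 bin_small.
elim: k => [|k IHk]; first by rewrite symseq0 bin0.
rewrite symseqS size_cat size_map IHs IHk.
by rewrite /= !addSn !addnS !subn1 /= binS.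
Qed.

Section Chain.
Variable K : fieldType.
Implicit Types (s t u : seq K) (a b c d x y : K).

(** Witt's chain equivalence of diagonal forms, given by their lists of
    coefficients. The new basis of the plane <a, b> consists of a vector of
    coordinates (x, y) and a vector orthogonal to it, whose norm is a b times
    that of the first one. Symmetry is a constructor because the inverse of a
    binary move is a binary move only up to squares. *)
Inductive chain : seq K -> seq K -> Prop :=
| chain_perm s t : perm_eq s t -> chain s t
| chain_scale a x s : x != 0 -> chain (a :: s) (a * x ^+ 2 :: s)
| chain_bin a b x y s : a != 0 -> b != 0 -> a * x ^+ 2 + b * y ^+ 2 != 0 ->
    chain (a :: b :: s) (a * x ^+ 2 + b * y ^+ 2 ::
                         a * b * (a * x ^+ 2 + b * y ^+ 2) :: s)
| chain_cons x s t : chain s t -> chain (x :: s) (x :: t)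
| chain_sym s t : chain s t -> chain t s
| chain_trans t s u : chain s t -> chain t u -> chain s u.

Lemma chain_refl s : chain s s.
Proof. exact/chain_perm/perm_refl. Qed.

Lemma chain_size s t : chain s t -> size s = size t.
Proof.
elim=> //= [{}s {}t /perm_size //|x {}s {}t _ ->//|t' {}s {}u _ -> _ //].
Qed.

Lemma chain_catl u s t : chain s t -> chain (u ++ s) (u ++ t).
Proof. by elim: u => //= x u IHu /IHu; apply: chain_cons. Qed.

Lemma chain_catr u s t : chain s t -> chain (s ++ u) (t ++ u).
Proof.
have cC v : chain (v ++ u) (u ++ v) by apply: chain_perm; rewrite perm_catC.
move=> st; apply: chain_trans (cC s) _; apply: chain_trans (chain_sym (cC t)).
exact: chain_catl.
Qed.

Lemma chain_cat s s' t t' :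
  chain s s' -> chain t t' -> chain (s ++ t) (s' ++ t').
Proof. by move=> /(chain_catr t) ss' /(chain_catl s'); apply: chain_trans. Qed.

(** For x = 0 the products with x are lists of zeros, so that only the
    lengths matter. *)
Lemma chain_mul x s t : chain s t -> chain (map ( *%R x) s) (map ( *%R x) t).
Proof.
have [-> st|x0] := eqVneq x 0.
  have map0 v : map ( *%R 0) v = nseq (size v) (0 : K).
    by elim: v => //= y v ->; rewrite mul0r.
  by rewrite !map0 (chain_size st); apply: chain_refl.
elim=> [{}s {}t st|a y {}s y0|a b y z {}s a0 b0 c0|y {}s {}t _|{}s {}t _|].
- exact/chain_perm/perm_map.
- by rewrite /= mulrA; apply: chain_scale.
- rewrite /=; set c := a * _ + _ in c0 *.
  have [xa0 xb0] : x * a != 0 /\ x * b != 0 by rewrite !mulf_neq0.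
  have Dc : x * a * y ^+ 2 + x * b * z ^+ 2 = x * c by rewrite /c; ring.
  have xc0 : x * a * y ^+ 2 + x * b * z ^+ 2 != 0 by rewrite Dc mulf_neq0.
  apply: chain_trans (chain_bin _ xa0 xb0 xc0) _; rewrite Dc.
  apply/chain_cons/chain_sym.
  have -> : x * a * (x * b) * (x * c) = x * (a * b * c) * x ^+ 2 by ring.
  exact: chain_scale.
- exact: chain_cons.
- exact: chain_sym.
- by move=> t' {}s {}u _ st' _ tu'; apply: chain_trans tu'.
Qed.

Lemma chain_mul_sq z x s : x != 0 ->
  chain (map ( *%R z) s) (map ( *%R (z * x ^+ 2)) s).
Proof.
move=> x0; elim: s => [|y s IHs] /=; first exact: chain_refl.
rewrite mulrAC; apply: chain_trans (chain_cons _ IHs) _.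
exact: chain_scale.
Qed.

Lemma chain_sq x s : x != 0 -> chain s (map ( *%R (x ^+ 2)) s).
Proof.
move=> x0; have := chain_mul_sq 1 s x0; rewrite mul1r.
by rewrite (eq_map (@mul1r K)) map_id.
Qed.

(** Modulo squares 1/(1 - a t) is (1 + a t)/(1 - t^2), as a^2 is a square. *)
Lemma chain_symseqSS a s k : a != 0 ->
  chain (symseq (a :: s) k.+2)
        (symseq s k.+2 ++ map ( *%R a) (symseq s k.+1) ++ symseq (a :: s) k).
Proof.
move=> a0; rewrite 2!symseqS map_cat -map_comp; do 2!apply: chain_catl.
apply: chain_sym; rewrite (eq_map (g := *%R (a ^+ 2))); first exact: chain_sq.
by move=> y /=; rewrite expr2 mulrA.
Qed.

Definition shift1 (x : K) (G : nat -> seq K) k :=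
  if k is k'.+1 then map ( *%R x) (G k') else [::].

(** Families of lists indexed by the degree stand for power series in t whose
    coefficients are diagonal forms; this is the product by 1 + x t. *)
Definition tensor1 (x : K) (G : nat -> seq K) k := G k ++ shift1 x G k.

(** The product by 1/(1 - t^2). *)
Fixpoint geom (G : nat -> seq K) k :=
  G k ++ if k is k'.+2 then geom G k' else [::].

Lemma nat_ind2 (P : nat -> Prop) :
  P 0 -> P 1 -> (forall k, P k -> P k.+2) -> forall k, P k.
Proof.
move=> P0 P1 PS k; suff: P k /\ P k.+1 by case.
by elim: k => // k [Pk PSk]; split=> //; apply: PS.
Qed.

Lemma chain_geom G G' :
  (forall k, chain (G k) (G' k)) -> forall k, chain (geom G k) (geom G' k).
Proof.
move=> GG'; elim/nat_ind2 => [||k IHk] /=; rewrite ?cats0 //.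
exact: chain_cat.
Qed.

Lemma chain_shift1 x G G' :
  (forall k, chain (G k) (G' k)) ->
  forall k, chain (shift1 x G k) (shift1 x G' k).
Proof. by move=> GG' [|k]; [apply: chain_refl|apply: chain_mul]. Qed.

Lemma chain_symseq_geom a s k : a != 0 ->
  chain (symseq (a :: s) k) (geom (tensor1 a (symseq s)) k).
Proof.
move=> a0; elim/nat_ind2: k => [||k IHk].
- by rewrite /= /tensor1 /= !cats0; apply: chain_refl.
- by rewrite /= /tensor1 /= !cats0; apply: chain_refl.
- apply: chain_trans (chain_symseqSS s k a0) _.
  by rewrite /= /tensor1 /= catA; apply: chain_catl.
Qed.

Lemma tensor1_geom a G k :
  perm_eq (tensor1 a (geom G) k) (geom (tensor1 a G) k).
Proof.
elim/nat_ind2: k => [||k IHk]; rewrite /tensor1 /= ?cats0 //.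
rewrite map_cat -!catA perm_cat2l perm_catCA perm_cat2l.
move: IHk; rewrite /tensor1; apply: perm_trans.
by rewrite perm_cat2l; case: k => [|[]].
Qed.

(** The product by a b t^2 is written with two shifts, as shift1 1 is the
    product by t. *)
Lemma tensor1_comm a b G k :
  perm_eq (tensor1 a (tensor1 b G) k)
          (G k ++ (shift1 a G k ++ shift1 b G k) ++
           shift1 (a * b) (shift1 1 G) k).
Proof.
rewrite /tensor1 -!catA perm_cat2l; case: k => //= k.
rewrite map_cat perm_catCA perm_cat2l perm_cat2l; case: k => //= k.
rewrite -!map_comp; set u := map _ _; set v := map _ _.
suff -> : u = v by []; by apply: eq_map => x /=; rewrite mul1r mulrA.
Qed.

(** The tensor product by a fixed form respects the isometry of binary forms. *)
Lemma chain_map_pair a b c d u :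
  chain [:: a; b] [:: c; d] ->
  chain (map ( *%R a) u ++ map ( *%R b) u) (map ( *%R c) u ++ map ( *%R d) u).
Proof.
move=> abcd; elim: u => [|y u IHu] /=; first exact: chain_refl.
have pA (z t : K) (v w : seq K) :
    perm_eq (z :: v ++ t :: w) ([:: z; t] ++ (v ++ w)).
  by rewrite /= perm_cons -cat1s perm_catCA.
apply: chain_trans (chain_perm (pA _ _ _ _)) _; apply: chain_sym.
apply: chain_trans (chain_perm (pA _ _ _ _)) _; apply: chain_sym.
apply: chain_cat IHu.
by move: (chain_mul y abcd); rewrite /= !(mulrC y).
Qed.

(** Modulo squares the series of a :: b :: s is that of s multiplied by (1 +
    (a + b) t + a b t^2)/(1 - t^2)^2. This depends only on the form <a, b>
    and on its determinant, which is known up to squares. *)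
Lemma chain_symseq2 a b c d x s k :
  a != 0 -> b != 0 -> x != 0 -> c * d = a * b * x ^+ 2 ->
  chain [:: a; b] [:: c; d] ->
  chain (symseq (a :: b :: s) k) (symseq (c :: d :: s) k).
Proof.
move=> a0 b0 x0 cd abcd.
have [c0 d0] : c != 0 /\ d != 0.
  by apply/andP; rewrite -negb_or -mulf_eq0 cd !mulf_neq0 ?expf_neq0.
have expand y z : y != 0 -> z != 0 ->
    chain (symseq [:: y, z & s] k)
      (geom (geom (fun k => let G := symseq s in
         G k ++ (shift1 y G k ++ shift1 z G k) ++
           shift1 (y * z) (shift1 1 G) k)) k).
  move=> y0 z0; apply: chain_trans (chain_symseq_geom _ _ y0) _.
  apply: chain_geom => {}k.
  apply: (chain_trans (t := tensor1 y (geom (tensor1 z (symseq s))) k)).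
    apply: chain_cat; first exact: chain_symseq_geom.
    by apply: chain_shift1 => j; apply: chain_symseq_geom.
  apply: chain_trans (chain_perm (tensor1_geom _ _ _)) _.
  apply: chain_geom => {}k; exact/chain_perm/tensor1_comm.
apply: chain_trans (expand _ _ a0 b0) _; apply: chain_sym.
apply: chain_trans (expand _ _ c0 d0) _; apply: chain_sym.
move: k {expand} => k; do 2!apply: chain_geom => {}k; apply: chain_catl.
apply: chain_cat.
  by case: k => [|k]; [exact: chain_refl|exact: chain_map_pair].
case: k => [|k] /=; first exact: chain_refl.
by rewrite cd; apply: chain_mul_sq.
Qed.

(** Expanding the symmetric power along both variables gives a recursion of
    step 2 that is symmetric in a and b. It needs the two previous degrees,
    hence the induction on pairs of consecutive degrees. No factor is
    discarded as a square, so that zero coefficients are allowed. *)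
Lemma perm_symseq_swap a b s k :
  perm_eq (symseq (a :: b :: s) k) (symseq (b :: a :: s) k).
Proof.
pose T y z := symseq [:: y, z & s]; rewrite -![symseq _ k]/(T _ _ _).
have step y z j : perm_eq (T y z j.+1) (T z y j.+1) ->
    perm_eq (T y z j.+2) (symseq s j.+2 ++
      (map ( *%R z) (symseq (z :: s) j.+1) ++
       map ( *%R y) (symseq (y :: s) j.+1)) ++
      map ( *%R (y * z)) (T z y j)).
  move=> IH; rewrite [T y z j.+2]symseqS (symseqS z s) -!catA !perm_cat2l.
  rewrite -/(T y z j.+1) (perm_trans (perm_map _ IH)) //.
  rewrite [T z y j.+1]symseqS map_cat -map_comp perm_cat2l.
  set u := map _ _; set v := map _ _; suff -> : u = v by [].
  by apply: eq_map => w /=; rewrite mulrA.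
(* The step relates degree k + 2 to both degrees k and k + 1. *)
suff: perm_eq (T a b k) (T b a k) /\ perm_eq (T a b k.+1) (T b a k.+1) by case.
elim: k => [|k [IHk IHSk]].
  split; first by rewrite /T !symseq0.
  by rewrite /T /= -!catA perm_cat2l !symseq0 /= (perm_catC [:: _] [:: _]).
split=> //; apply: perm_trans (step _ _ _ IHSk) _; rewrite perm_sym in IHSk.
rewrite perm_sym; apply: perm_trans (step _ _ _ IHSk) _.
rewrite perm_cat2l (mulrC b); apply: perm_cat; first by rewrite perm_catC.
exact: perm_map.
Qed.

Lemma chain_symseq_cons x s t k : (forall k, chain (symseq s k) (symseq t k)) ->
  chain (symseq (x :: s) k) (symseq (x :: t) k).
Proof.
move=> st; elim: k => [|k IHk]; first by rewrite !symseq0; apply: chain_refl.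
by rewrite !symseqS; apply: chain_cat => //; apply: chain_mul.
Qed.

Lemma chain_symseq_perm s t k : perm_eq s t -> chain (symseq s k) (symseq t k).
Proof.
elim: s t k => [|x s IHs] t k.
  by rewrite perm_sym => /perm_nilP->; apply: chain_refl.
move=> xst; have xt: x \in t by rewrite -(perm_mem xst) mem_head.
case/splitPr: xt xst => t1 t2 xst.
have {}/IHs IHs: perm_eq s (t1 ++ t2).
  by rewrite -(perm_cons x) (perm_trans xst) // -cat1s perm_catCA.
apply: chain_trans (chain_symseq_cons _ _ IHs) _.
elim: t1 k {xst IHs} => [|y t1 IHt] k; first exact: chain_refl.
apply: chain_trans (chain_perm (perm_symseq_swap _ _ _ _)) _.
exact: chain_symseq_cons.
Qed.

(** By induction on the chain: the moves on one or two coefficients are seen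
    on the generating series, and a common head is put back by the recursion
    on the degree. *)
Lemma chain_symseq s t k : chain s t -> chain (symseq s k) (symseq t k).
Proof.
move=> st; elim: st k => {s t}.
- by move=> s t st k; apply: chain_symseq_perm.
- move=> a x s x0 k; elim: k => [|k IHk].
    by rewrite !symseq0; apply: chain_refl.
  rewrite !symseqS; apply: chain_catl; apply: chain_trans (chain_mul a IHk) _.
  exact: chain_mul_sq.
- move=> a b x y s a0 b0 c0 k; set c := _ + _ in c0 *.
  apply: (chain_symseq2 _ _ a0 b0 c0); first by rewrite expr2 mulrC !mulrA.
  exact: chain_bin.
- by move=> x s t _ IHst k; apply: chain_symseq_cons.
- by move=> s t _ IHst k; apply: chain_sym.
- by move=> t s u _ IHst _ IHtu k; apply: chain_trans (IHst k) (IHtu k).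
Qed.

End Chain.

(** * Isometries between diagonal forms *)

Section Isometric.
Variable K : fieldType.
Implicit Types V W X : vectType K.

Lemma isometric_intro V W (q : V -> K) (q' : W -> K) (f : V -> W) (g : W -> V) :
  linear f -> cancel f g -> cancel g f -> (forall v, q' (f v) = q v) ->
  isometric q q'.
Proof.
move=> lin_f fK gK qf.
pose F : {linear V -> W} :=
  HB.pack f (GRing.isLinear.Build K V W *:%R f lin_f).
by exists F; first exists g.
Qed.

Lemma isometric_refl V (q : V -> K) : isometric q q.
Proof. by apply: (isometric_intro (f := id) (g := id)). Qed.

Lemma isometric_sym V W (q : V -> K) (q' : W -> K) :
  isometric q q' -> isometric q' q.
Proof.
case=> f [g fK gK] qf; apply: (isometric_intro (f := g) (g := f)) => //.
  exact: can2_linear fK gK.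
by move=> w; rewrite -qf gK.
Qed.

Lemma isometric_trans V W X (q : V -> K) (q' : W -> K) (q'' : X -> K) :
  isometric q q' -> isometric q' q'' -> isometric q q''.
Proof.
case=> f fB qf [g gB qg]; exists (g \o f); first exact: bij_comp.
by move=> v; rewrite /= qg qf.
Qed.

Lemma isometric_perp V V' W W' (q : V -> K) (q' : V' -> K)
    (p : W -> K) (p' : W' -> K) :
  isometric q q' -> isometric p p' -> isometric (perp q p) (perp q' p').
Proof.
case=> f [f' fK f'K] qf [g [g' gK g'K] pg].
apply: (isometric_intro (f := fun v => (f v.1, g v.2))
                        (g := fun v => (f' v.1, g' v.2))).
- by move=> x u v; rewrite /= !linearP.
- by case=> u v /=; rewrite fK gK.
- by case=> u v /=; rewrite f'K g'K.
- by move=> v; rewrite /perp /= qf pg.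
Qed.

Lemma isometric_reindex (I J : finType) (h : J -> I) (c : I -> K) :
  bijective h -> isometric (diag_form c) (diag_form (c \o h)).
Proof.
case=> h' hK h'K.
pose f (v : {ffun I -> K^o}) : {ffun J -> K^o} := [ffun j => v (h j)].
pose g (v : {ffun J -> K^o}) : {ffun I -> K^o} := [ffun i => v (h' i)].
apply: (isometric_intro (f := f) (g := g)).
- by move=> x u v; apply/ffunP => j; rewrite !ffunE.
- by move=> v; apply/ffunP => i; rewrite !ffunE h'K.
- by move=> v; apply/ffunP => i; rewrite !ffunE hK.
- move=> v; rewrite /diag_form [RHS](reindex h) /=; last by exists h' => x _.
  by apply: eq_bigr => j _; rewrite ffunE.
Qed.

Lemma eq_diag_form (I : finType) (c c' : I -> K) :
  c =1 c' -> isometric (diag_form c) (diag_form c').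
Proof.
move=> cc'; apply: (isometric_intro (f := id) (g := id)) => // v.
by apply: eq_bigr => i _; rewrite cc'.
Qed.

Lemma isometric_sum (I J : finType) (c : I -> K) (c' : J -> K) :
  isometric (perp (diag_form c) (diag_form c'))
    (diag_form (fun i : I + J =>
       match i with inl i => c i | inr j => c' j end)).
Proof.
pose f (v : ({ffun I -> K^o} * {ffun J -> K^o})%type) : {ffun I + J -> K^o} :=
  [ffun i : I + J => match i with inl i => v.1 i | inr j => v.2 j end].
pose g (v : {ffun I + J -> K^o}) : ({ffun I -> K^o} * {ffun J -> K^o})%type :=
  ([ffun i => v (inl i)], [ffun j => v (inr j)]).
apply: (isometric_intro (f := f) (g := g)).
- by move=> x u v; apply/ffunP => -[] i; rewrite !ffunE.
- by case=> u v; congr pair; apply/ffunP => i; rewrite !ffunE.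
- by move=> v; apply/ffunP => -[] i; rewrite !ffunE.
- move=> v; rewrite /diag_form big_sumType /=.
  by congr (_ + _); apply: eq_bigr => i _; rewrite ffunE.
Qed.

Lemma isometric_copies (I : finType) (c : I -> K) r :
  isometric (copies r (diag_form c)) (diag_form (fun i : 'I_r * I => c i.2)).
Proof.
pose f (v : {ffun 'I_r -> {ffun I -> K^o}}) : {ffun 'I_r * I -> K^o} :=
  [ffun i : 'I_r * I => v i.1 i.2].
pose g (v : {ffun 'I_r * I -> K^o}) : {ffun 'I_r -> {ffun I -> K^o}} :=
  [ffun i => [ffun j => v (i, j)]].
apply: (isometric_intro (f := f) (g := g)).
- by move=> x u v; apply/ffunP => i; rewrite !ffunE.
- by move=> v; apply/ffunP => i; apply/ffunP => j; rewrite !ffunE.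
- by move=> v; apply/ffunP => -[i j]; rewrite !ffunE.
- move=> v; rewrite /copies /diag_form pair_bigA /=.
  by apply: eq_bigr => i _; rewrite ffunE.
Qed.

(** Coefficients are indexed by monomials, pairs, sums or ordinals; comparing
    their multisets avoids explicit bijections between these types. *)
Lemma isometric_perm (I J : finType) (c : I -> K) (c' : J -> K) :
  perm_eq (codom c) (codom c') -> isometric (diag_form c) (diag_form c').
Proof.
move=> cc'.
have [h [h_inj hB] ch] : exists2 h : J -> I, injective h /\ #|J| = #|I| &
    c \o h =1 c'.
  have eIJ : #|J| = #|I| by have /perm_size := cc'; rewrite !size_codom.
  rewrite perm_sym in cc'.
  have /(perm_iotaP 0)[s s_perm c'E] := cc'.
  have sz_s : size s = #|I| by rewrite (perm_size s_perm) size_iota size_codom.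
  have s_lt (j : J) : (nth 0 s (enum_rank j) < #|I|)%N.
    have : nth 0%N s (enum_rank j) \in s by rewrite mem_nth // sz_s -eIJ.
    by rewrite (perm_mem s_perm) mem_iota size_codom.
  exists (fun j => enum_val (Ordinal (s_lt j))).
    split=> // i j /enum_val_inj/(congr1 val)/= /eqP.
    rewrite nth_uniq ?(perm_uniq s_perm) ?iota_uniq ?sz_s -?eIJ //.
    by move=> /eqP/val_inj/enum_rank_inj.
  move=> j /=; have := congr1 (nth 0 ^~ (enum_rank j)) c'E.
  rewrite nth_codom enum_rankK (nth_map 0%N) ?sz_s -?eIJ // => ->.
  by rewrite -(nth_codom 0 c (Ordinal (s_lt j))).
apply: isometric_trans (isometric_reindex c (h := h) _) (eq_diag_form ch).
by apply: inj_card_bij => //; rewrite hB.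
Qed.

Lemma codom_tnth (R : Type) n (t : n.-tuple R) : codom (tnth t) = t.
Proof. by rewrite codomE map_tnth_enum. Qed.

Definition isoseq (s t : seq K) :=
  isometric (diag_form (tnth (in_tuple s))) (diag_form (tnth (in_tuple t))).

Lemma codom_in_tuple (s : seq K) : codom (tnth (in_tuple s)) = s.
Proof. exact: codom_tnth. Qed.

Lemma isoseq_cat s s' t t' :
  isoseq s s' -> isoseq t t' -> isoseq (s ++ t) (s' ++ t').
Proof.
have cat2 (u v : seq K) : isometric (diag_form (tnth (in_tuple (u ++ v))))
   (perp (diag_form (tnth (in_tuple u))) (diag_form (tnth (in_tuple v)))).
  apply: isometric_trans _ (isometric_sym (isometric_sum _ _)).
  apply: isometric_perm; rewrite codom_in_tuple.
  rewrite /codom /image_mem enumT unlock /= /sum_enum map_cat -!map_comp.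
  rewrite -[X in perm_eq (X ++ _) _]codom_in_tuple.
  by rewrite -[X in perm_eq (_ ++ X) _]codom_in_tuple !codomE !enumT.
move=> ss' tt'; apply: isometric_trans (cat2 _ _) _.
by apply: isometric_trans _ (isometric_sym (cat2 _ _)); apply: isometric_perp.
Qed.

Lemma isoseq_scale a x : x != 0 -> isoseq [:: a] [:: a * x ^+ 2].
Proof.
move=> x0; pose scale y (v : {ffun 'I_1 -> K^o}) := y *: v.
apply: (isometric_intro (f := scale x^-1) (g := scale x)); rewrite /scale.
- by move=> z u v; rewrite scalerDr !scalerA mulrC.
- by move=> v; rewrite scalerA divff ?scale1r.
- by move=> v; rewrite scalerA mulVf ?scale1r.
- move=> v; rewrite /diag_form !big_ord_recl !big_ord0 !ffunE /= /tnth /=.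
  by rewrite /GRing.scale /=; field.
Qed.

(** The vectors (x, y) and (- b y, a x) are orthogonal for <a, b>, with the
    two norms of the right-hand side. *)
Lemma isoseq_bin a b x y : a * x ^+ 2 + b * y ^+ 2 != 0 ->
  isoseq [:: a; b] [:: a * x ^+ 2 + b * y ^+ 2;
                       a * b * (a * x ^+ 2 + b * y ^+ 2)].
Proof.
move=> c0; apply: isometric_sym.
pose o0 : 'I_2 := ord0; pose o1 : 'I_2 := lift ord0 ord0.
pose pair2 (u w : K) : {ffun 'I_2 -> K^o} :=
  [ffun i => if i == o0 then u else w].
have ff2P (v w : {ffun 'I_2 -> K^o}) : v o0 = w o0 -> v o1 = w o1 -> v = w.
  move=> e0 e1; apply/ffunP=> -[[|[|//]] i].
    by rewrite (_ : Ordinal i = o0) //; apply: val_inj.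
  by rewrite (_ : Ordinal i = o1) //; apply: val_inj.
set c := _ + _ in c0 *.
pose f (v : {ffun 'I_2 -> K^o}) :=
  pair2 (x * v o0 - b * y * v o1) (y * v o0 + a * x * v o1).
pose g (v : {ffun 'I_2 -> K^o}) :=
  pair2 ((a * x * v o0 + b * y * v o1) / c) ((x * v o1 - y * v o0) / c).
apply: (isometric_intro (f := f) (g := g)); rewrite /f /g.
- by move=> z u v; apply: ff2P; rewrite !ffunE /= /GRing.scale /=; ring.
- by move=> v; apply: ff2P; rewrite !ffunE /= /GRing.scale /= /c; field.
- by move=> v; apply: ff2P; rewrite !ffunE /= /GRing.scale /= /c; field.
- move=> v; rewrite /diag_form !big_ord_recl !big_ord0 !ffunE /= /tnth /=.
  by rewrite -/o0 -/o1 /c; ring.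
Qed.

(** Each elementary move of a chain is realized by a change of orthogonal
    basis of a line or a plane. *)
Lemma chain_isoseq s t : chain s t -> isoseq s t.
Proof.
elim=> {s t}.
- by move=> s t st; apply: isometric_perm; rewrite !codom_in_tuple.
- move=> a x s x0; rewrite -cat1s -[_ :: s]cat1s.
  by apply: isoseq_cat (isometric_refl _); apply: isoseq_scale.
- move=> a b x y s _ _ c0; rewrite -(cat1s a) -(cat1s b) catA.
  apply: (@isoseq_cat _ [:: _; _] s s) (isometric_refl _); exact: isoseq_bin.
- move=> x s t _ st; rewrite -(cat1s x s) -(cat1s x t).
  by apply: isoseq_cat st; apply: isometric_refl.
- by move=> s t _; apply: isometric_sym.
- by move=> t s u _ st _; apply: isometric_trans st.
Qed.

End Isometric.

(** * Witt's chain equivalence theorem *)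

Lemma perm_pairwise (T : eqType) (r : rel T) (s t : seq T) :
  symmetric r -> perm_eq s t -> pairwise r s -> pairwise r t.
Proof.
move=> rC; elim: s t => [|x s IHs] t.
  by rewrite perm_sym => /perm_nilP->.
move=> xst; have xt: x \in t by rewrite -(perm_mem xst) mem_head.
case/splitPr: xt xst => t1 t2 xst.
have {}xst: perm_eq s (t1 ++ t2).
  by rewrite -(perm_cons x) (perm_trans xst) // -cat1s perm_catCA.
rewrite pairwise_cons (perm_all _ xst) => /andP[+ /(IHs _ xst)].
rewrite all_cat !pairwise_cat pairwise_cons allrel_consr.
move=> /andP[xt1 ->] /and3P[-> -> ->]; rewrite !andbT.
by rewrite (eq_all (a2 := r x)).
Qed.

Lemma memv_span_cons (K : fieldType) (V : vectType K) (u v : V) (e : seq V) :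
  v \in <<u :: e>>%VS -> exists x, exists2 w, w \in <<e>>%VS & v = x *: u + w.
Proof.
rewrite span_cons => /memv_addP[_ /vlineP[x ->] [w ew ->]].
by exists x, w.
Qed.

Lemma memv_span_behead (K : fieldType) (V : vectType K) (u v : V) (e : seq V) :
  v \in <<e>>%VS -> v \in <<u :: e>>%VS.
Proof. by move=> ev; rewrite span_cons (subvP (addvSr _ _)). Qed.

(** The term with a nonzero coordinate is brought to the front by a
    permutation. *)
Lemma span_split (K : fieldType) (V : vectType K) (e : seq V) (v : V) :
  v \in <<e>>%VS -> v != 0 ->
  exists u e' x w, [/\ perm_eq e (u :: e'), x != 0, w \in <<e'>>%VS &
                       v = x *: u + w].
Proof.
elim: e v => [|u e IHe] v; first by rewrite span_nil memv0 => ->.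
case/memv_span_cons=> x [w ew ->] v0.
have [x0|x0] := eqVneq x 0; last by exists u, e, x, w; split=> //;
  exact: perm_refl.
move: v0; rewrite x0 scale0r add0r => /(IHe w ew)[u' [e' [y [w' [ee' y0 ew'
  ->]]]]].
exists u', (u :: e'), y, w'; split=> //; last exact: memv_span_behead.
rewrite (perm_trans (y := [:: u, u' & e'])) ?perm_cons //.
by rewrite (perm_catCA [:: u] [:: u'] e').
Qed.

Section Witt.
Variables (K : fieldType) (V : vectType K) (B : V -> V -> K).
Hypothesis char2 : 2%:R != 0 :> K.
Hypothesis BD : forall u v w, B (u + v) w = B u w + B v w.
Hypothesis BZ : forall x u v, B (x *: u) v = x * B u v.
Hypothesis BC : forall u v, B u v = B v u.

Let BDr u v w : B w (u + v) = B w u + B w v.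
Proof. by rewrite BC BD !(BC w). Qed.
Let BZr x u v : B u (x *: v) = x * B u v.
Proof. by rewrite BC BZ BC. Qed.
Let B0 u : B 0 u = 0.
Proof. by rewrite -(scale0r 0) BZ mul0r. Qed.

Definition orthobasis (e : seq V) :=
  all (fun u => B u u != 0) e && pairwise (fun u v => B u v == 0) e.

Definition norms (e : seq V) := [seq B u u | u <- e].

(** What a sequence of elementary changes of orthogonal basis preserves. *)
Definition rediag (e e' : seq V) :=
  [/\ orthobasis e', <<e>>%VS = <<e'>>%VS & chain (norms e) (norms e')].

Lemma rediag_trans e1 e2 e3 : rediag e1 e2 -> rediag e2 e3 -> rediag e1 e3.
Proof.
by case=> _ e12 c12 [o3 e23 c23]; split=> //; [rewrite e12|apply: chain_trans
  c23].
Qed.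

Lemma rediag_perm e e' : orthobasis e -> perm_eq e e' -> rediag e e'.
Proof.
move=> /andP[ne oe] ee'; split; last exact/chain_perm/perm_map.
  rewrite /orthobasis -(perm_all _ ee') ne /=.
  by apply: perm_pairwise oe => // u v; rewrite BC.
exact/eq_span/perm_mem.
Qed.

Lemma orthobasis_cons u e : orthobasis (u :: e) <->
  [/\ B u u != 0, {in <<e>>%VS, forall v, B u v = 0} & orthobasis e].
Proof.
rewrite /orthobasis /=; split.
  case/andP=> /andP[-> ->] /andP[/allP ue ->]; split=> // v.
  elim: e ue v => [|w e IHe] ue v; first by rewrite span_nil memv0 => /eqP->;
    rewrite BC.
  case/memv_span_cons=> x [v' ev' ->]; rewrite BDr BZr.
  rewrite (eqP (ue w _)) ?mem_head // mulr0 add0r; apply: IHe => // w' ew'.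
  by rewrite ue // inE ew' orbT.
case=> -> ue /andP[-> ->] /=; rewrite andbT; apply/allP => v ev.
by rewrite ue ?memv_span.
Qed.

Lemma rediag_cons u e e' :
  orthobasis (u :: e) -> rediag e e' -> rediag (u :: e) (u :: e').
Proof.
case/orthobasis_cons=> u0 ue oe [oe' ee' cee']; split.
- by apply/orthobasis_cons; rewrite -ee'.
- by rewrite !span_cons ee'.
- exact: chain_cons.
Qed.

(** In the plane of u and w the orthogonal of v = x u + y w is spanned by the
    second vector, whose norm is the product of B u u, B w w and B v v. *)
Lemma rediag_bin u w e x y (v := x *: u + y *: w) :
  orthobasis [:: u, w & e] -> B v v != 0 ->
  rediag [:: u, w & e]
         [:: v, (- (B w w * y)) *: u + (B u u * x) *: w & e].
Proof.
move=> /orthobasis_cons[u0 uP /orthobasis_cons[w0 wP oe]] v0.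
have uw : B u w = 0 by rewrite uP ?memv_span ?mem_head.
have ue z : z \in <<e>>%VS -> B u z = 0.
  by move=> ez; apply: uP; apply: memv_span_behead.
have Dv : B v v = B u u * x ^+ 2 + B w w * y ^+ 2.
  by rewrite /v !BD !BZ !BDr !BZr (BC w) uw; ring.
rewrite Dv in v0; set c := _ + _ in Dv v0; set v' := _ + _ *: w.
have Dv' : B v' v' = B u u * B w w * c.
  by rewrite /v' /c !BD !BZ !BDr !BZr (BC w) uw; ring.
have vv' : B v v' = 0 by rewrite /v' /v !BD !BZ !BDr !BZr (BC w) uw; ring.
split.
- apply/orthobasis_cons; split; rewrite ?Dv //.
    move=> _ /memv_span_cons[z [t et ->]].
    by rewrite BDr BZr vv' mulr0 add0r /v BD !BZ ue ?wP // !mulr0 addr0.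
  apply/orthobasis_cons; split=> //; first by rewrite Dv' !mulf_neq0.
  by move=> t et; rewrite /v' BD !BZ (ue t) ?(wP t) // !mulr0 addr0.
- have Du : u = (B u u * x / c) *: v + (- (y / c)) *: v'.
    rewrite /v /v' !scalerDr !scalerA addrACA -!scalerDl -[LHS]scale1r.
    rewrite -[LHS]addr0 -[in LHS](scale0r w); congr (_ *: _ + _ *: _).
      by rewrite /c; field.
    by rewrite /c; field.
  have Dw : w = (B w w * y / c) *: v + (x / c) *: v'.
    rewrite /v /v' !scalerDr !scalerA addrACA -!scalerDl -[LHS]scale1r.
    rewrite -[LHS]add0r -[in LHS](scale0r u); congr (_ *: _ + _ *: _).
      by rewrite /c; field.
    by rewrite /c; field.
  have sub p q r s : p \in <<[:: r, s & e]>>%VS -> q \in <<[:: r, s & e]>>%VS ->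
      (<<[:: p, q & e]>> <= <<[:: r, s & e]>>)%VS.
    move=> rp rq; apply/span_subvP => z; rewrite !inE =>
      /or3P[/eqP->|/eqP->|ez] //.
    by rewrite memv_span // !inE ez !orbT.
  have in2 p q z t : z *: p + t *: q \in <<[:: p, q & e]>>%VS.
    by rewrite memvD // memvZ // memv_span // !inE eqxx ?orbT.
  apply/eqP; rewrite eqEsubv; apply/andP; split; apply: sub.
  - by rewrite Du in2.
  - by rewrite Dw in2.
  - exact: in2.
  - exact: in2.
- by rewrite /norms /= Dv Dv'; apply: chain_bin.
Qed.

Lemma rediag_scale u e x : orthobasis (u :: e) -> x != 0 ->
  rediag (u :: e) (x *: u :: e).
Proof.
move=> oue x0; have [u0 uP oe] := (orthobasis_cons _ _).1 oue; split.
- apply/orthobasis_cons; split=> //; first by rewrite BZ BZr !mulf_neq0.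
  by move=> v ev; rewrite BZ uP ?mulr0.
- rewrite !span_cons; congr (_ + _)%VS.
  apply/eqP; rewrite eqEsubv -!memvE; apply/andP; split; apply/vlineP.
    by exists x^-1; rewrite scalerA mulVf ?scale1r.
  by exists x.
- have -> : norms (x *: u :: e) = B u u * x ^+ 2 :: norms e.
    by rewrite /norms /= BZ BZr; congr (_ :: _); ring.
  exact: chain_scale.
Qed.

(** Any anisotropic vector of the span can be made the head of an orthogonal
    basis by elementary moves. The head u of the basis is peeled off, v = x u
    + w, and the induction hypothesis applies to w unless w is isotropic. In
    that case w involves some t with a coefficient y, so that v = x u + y t +
    s. As s and y t have opposite norms and 2 is invertible, x u + y t and x
    u + s are not both isotropic, and grouping v along one of them reduces
    the dimension. *)
Lemma rediag_complete e v : orthobasis e -> v \in <<e>>%VS -> B v v != 0 ->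
  exists e', rediag e (v :: e').
Proof.
elim: {e}(size e) {-2}e (leqnn (size e)) v => [|n IHn] [|u e] //= sz_e v oe ev
  v0.
- by move: ev v0; rewrite span_nil memv0 => /eqP->; rewrite B0 eqxx.
- by move: ev v0; rewrite span_nil memv0 => /eqP->; rewrite B0 eqxx.
rewrite ltnS in sz_e.
have recombine p d x z : (size d <= n)%N -> orthobasis (p :: d) ->
    z \in <<d>>%VS -> B z z != 0 -> v = x *: p + z ->
    exists e', rediag (p :: d) (v :: e').
  move=> sz_d opd dz z0 Dv; have [_ _ od] := (orthobasis_cons _ _).1 opd.
  have [e' rde'] := IHn d sz_d z od dz z0.
  have rw := rediag_cons opd rde'; have [ow _ _] := rw.
  exists ((- (B z z * 1)) *: p + (B p p * x) *: z :: e').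
  apply: rediag_trans rw _; move: (@rediag_bin p z e' x 1 ow).
  by rewrite scale1r -Dv; apply.
have [u0 uP oe'] := (orthobasis_cons u e).1 oe.
have [x [w ew Dv]] := memv_span_cons ev.
have [w0|w0] := eqVneq (B w w) 0; last exact: recombine oe ew w0 Dv.
have x0 : x != 0.
  apply: contraNneq v0 => x0.
  by rewrite Dv x0 scale0r add0r w0.
have [wz|wz] := eqVneq w 0.
  by exists e; rewrite Dv wz addr0; apply: rediag_scale.
have [t [d [y [s [etd y0 ds Dw]]]]] := span_split ew wz.
have sz_d : (size d < n)%N by move: sz_e; rewrite (perm_size etd).
have pe : perm_eq (u :: e) [:: u, t & d] by rewrite perm_cons.
have rutd := rediag_perm oe pe; have [outd _ _] := rutd.
have [_ uP' otd] := (orthobasis_cons _ _).1 outd.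
have [t0 tP od] := (orthobasis_cons _ _).1 otd.
have ut : B u t = 0 by rewrite uP' // memv_span ?mem_head.
have us : B u s = 0 by rewrite uP' // memv_span_behead.
have ts : B t s = 0 by rewrite tP.
have Ds : B s s = - (B t t * y ^+ 2).
  move: w0; rewrite Dw !BD !BZ !BDr !BZr (BC s) ts => Bs; apply/eqP.
  by rewrite -subr_eq0 opprK -Bs; apply/eqP; ring.
(* Group v as g + s or as h + y t, with g or h anisotropic. *)
pose g := x *: u + y *: t.
have [g0|g0] := eqVneq (B g g) 0; last first.
  pose g' := - (B t t * y) *: u + (B u u * x) *: t.
  have rg := rediag_bin outd g0; rewrite -/g -/g' in rg.
  have [og _ _] := rg.
  have rg' := rediag_perm og (permEl (perm_catCA [:: g] [:: g'] d)).
  rewrite /= in rg'; have [og' _ _] := rg'.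
  have [_ _ ogd] := (orthobasis_cons _ _).1 og'.
  have gdv : v \in <<g :: d>>%VS.
    by rewrite Dv Dw addrA memvD // ?(memv_span (mem_head _ _)) //
      memv_span_behead.
  have [e' re'] := IHn (g :: d) sz_d v ogd gdv v0.
  have r' := rediag_cons og' re'; have [o' _ _] := r'.
  exists (g' :: e'); apply: rediag_trans rutd _; apply: rediag_trans rg _.
  apply: rediag_trans rg' _; apply: rediag_trans r' _.
  exact: rediag_perm o' (permEl (perm_catCA [:: g'] [:: v] e')).
pose h := x *: u + s.
have Bg : B u u * x ^+ 2 = - (B t t * y ^+ 2).
  move: g0; rewrite /g !BD !BZ !BDr !BZr (BC t) ut => Bs; apply/eqP.
  by rewrite -subr_eq0 opprK -Bs; apply/eqP; ring.
have h0 : B h h != 0.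
  have -> : B h h = 2%:R * (B u u * x ^+ 2).
    by rewrite /h !BD !BZ !BDr !BZr (BC s) us Ds -Bg; ring.
  by rewrite !mulf_neq0.
have rt := rediag_perm outd (permEl (perm_catCA [:: u] [:: t] d)).
rewrite /= in rt; have [ot _ _] := rt.
have hud : h \in <<u :: d>>%VS.
  by rewrite memvD // ?memvZ ?(memv_span (mem_head _ _)) // memv_span_behead.
have [e' re'] : exists e', rediag [:: t, u & d] (v :: e').
  by apply: recombine ot hud h0 _ => //; rewrite Dv Dw /h addrCA.
exists e'; apply: rediag_trans rutd _; exact: rediag_trans rt re'.
Qed.

(** Witt's theorem for orthogonal bases. Once both bases have the same head
    v, their tails are orthogonal bases of the same space, the orthogonal of
    v in the common span. *)
Lemma chain_norms e f : orthobasis e -> orthobasis f -> <<e>>%VS = <<f>>%VS ->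
  chain (norms e) (norms f).
Proof.
elim: f e => [|v f IHf] e oe of_ ef.
  case: e oe ef => [|u e]; first by move=> *; apply: chain_refl.
  case/orthobasis_cons=> u0 _ _ ef; case/negP: u0.
  have : u \in <<[::]>>%VS by rewrite -ef memv_span ?mem_head.
  by rewrite span_nil memv0 => /eqP->; rewrite B0.
have [v0 vP of'] := (orthobasis_cons _ _).1 of_.
have [e' [oe' ee' cee']] : exists e', rediag e (v :: e').
  by apply: rediag_complete; rewrite ?ef // memv_span ?mem_head.
apply: chain_trans cee' _; apply: chain_cons.
have [_ vP' oe''] := (orthobasis_cons _ _).1 oe'.
(* The orthogonal of v in the common span determines the span of the tail. *)
have perpv (d d' : seq V) : {in <<d>>%VS, forall w, B v w = 0} ->
    {in <<d'>>%VS, forall w, B v w = 0} -> <<v :: d>>%VS = <<v :: d'>>%VS ->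
    (<<d>> <= <<d'>>)%VS.
  move=> dP d'P dd'; apply/subvP => w dw.
  have := memv_span_behead v dw; rewrite dd' => /memv_span_cons[x [z d'z Dw]].
  have /eqP: x * B v v = 0.
    by have := dP w dw; rewrite Dw BDr BZr (d'P z) // addr0.
  by rewrite mulf_eq0 (negPf v0) orbF Dw => /eqP->; rewrite scale0r add0r.
apply: IHf => //; have ve'f : <<v :: e'>>%VS = <<v :: f>>%VS by rewrite -ee'.
by apply/eqP; rewrite eqEsubv !perpv.
Qed.

End Witt.

(** Witt's chain equivalence theorem: an isometry carries the canonical basis
    to an orthogonal basis of the target, to be compared with the canonical
    one. *)
Lemma chain_isometric (K : fieldType) (I J : finType)
    (c : I -> K) (c' : J -> K) :
  2%:R != 0 :> K -> (forall i, c i != 0) -> (forall j, c' j != 0) ->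
  isometric (diag_form c) (diag_form c') -> chain (codom c) (codom c').
Proof.
move=> char2 c0 c'0 [f [g fK gK] qf].
pose B (u v : {ffun J -> K^o}) : K := \sum_j c' j * (u j * v j).
have BD u v w : B (u + v) w = B u w + B v w.
  by rewrite -big_split /=; apply: eq_bigr => j _; rewrite ffunE mulrDl mulrDr.
have BZ x u v : B (x *: u) v = x * B u v.
  by rewrite mulr_sumr; apply: eq_bigr => j _;
    rewrite ffunE -scalerAl /= mulrCA.
have BC u v : B u v = B v u by apply: eq_bigr => j _; rewrite (mulrC (u j)).
have BDr u v w : B w (u + v) = B w u + B w v by rewrite BC BD !(BC w).
have Bq u : B u u = diag_form c' u by apply: eq_bigr => j _; rewrite expr2.
pose B' (u v : {ffun I -> K^o}) : K := \sum_i c i * (u i * v i).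
have B'q u : B' u u = diag_form c u by apply: eq_bigr => j _; rewrite expr2.
have B'D u v : B' (u + v) (u + v) = B' u u + B' u v *+ 2 + B' v v.
  rewrite -sumrMnl -!big_split; apply: eq_bigr => i _; rewrite ffunE /=; ring.
have Bf u v : B (f u) (f v) = B' u v.
  have E : B (f (u + v)) (f (u + v)) = B' (u + v) (u + v) by rewrite Bq qf B'q.
  rewrite B'D linearD BD !BDr (BC (f v)) !Bq !qf -!B'q in E.
  apply/eqP; rewrite -subr_eq0 -(mulrI_eq0 _ (mulfI char2)) -(subrr (B' u u)).
  rewrite -[X in _ == X - _](addrK (B' u v *+ 2 + B' v v)) addrA -E.
  by apply/eqP; ring.
pose dl (T : finType) (i : T) : {ffun T -> K^o} := [ffun j => (i == j)%:R].
have B'dl i i' : B' (dl I i) (dl I i') = c i *+ (i == i').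
  rewrite /B' (bigD1 i) //= !ffunE eqxx big1 => [|j /negPf ji]; last first.
    by rewrite !ffunE eq_sym ji mul0r mulr0.
  by rewrite addr0 mul1r eq_sym mulr_natr.
have Bdl j j' : B (dl J j) (dl J j') = c' j *+ (j == j').
  rewrite /B (bigD1 j) //= !ffunE eqxx big1 => [|i /negPf ji]; last first.
    by rewrite !ffunE eq_sym ji mul0r mulr0.
  by rewrite addr0 mul1r eq_sym mulr_natr.
have span_dl T : <<[seq dl T i | i <- enum T]>>%VS = fullv.
  apply/eqP; rewrite eqEsubv subvf; apply/subvP => v _.
  have -> : v = \sum_i v i *: dl T i.
    apply/ffunP => i; rewrite sum_ffunE (bigD1 i) //= !ffunE eqxx.
    rewrite big1 ?addr0 => [|j /negPf ji]; first by rewrite /GRing.scale /=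
      mulr1.
    by rewrite !ffunE ji scaler0.
  by apply: memv_suml => i _; rewrite memvZ // memv_span // map_f ?mem_enum.
pose e := [seq f (dl I i) | i <- enum I]; pose e' := [seq dl J j | j <- enum J].
have pw (T : finType) (r : rel T) : (forall i j, i != j -> r i j) ->
    pairwise r (enum T).
  by move=> rP; apply: (sub_pairwise rP); rewrite -uniq_pairwise enum_uniq.
have -> : codom c = norms B e.
  by rewrite /norms -map_comp codomE; apply: eq_map => i /=;
    rewrite Bf B'dl eqxx.
have -> : codom c' = norms B e'.
  by rewrite /norms -map_comp codomE; apply: eq_map => i /=; rewrite Bdl eqxx.
apply: chain_norms => //.
- rewrite /orthobasis all_map pairwise_map; apply/andP; split.
    by apply/allP => i _; rewrite /= Bf B'dl eqxx mulr1n c0.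
  by apply: pw => i j /negPf ij; rewrite /= Bf B'dl ij.
- rewrite /orthobasis all_map pairwise_map; apply/andP; split.
    by apply/allP => i _; rewrite /= Bdl eqxx mulr1n c'0.
  by apply: pw => i j /negPf ij; rewrite /= Bdl ij.
- rewrite /e' span_dl; apply/eqP; rewrite eqEsubv subvf; apply/subvP => v _.
  rewrite -(gK v); have : g v \in <<[seq dl I i | i <- enum I]>>%VS.
    by rewrite span_dl memvf.
  move/(memv_img (linfun f)); rewrite limg_span -map_comp lfunE.
  by rewrite (eq_map (g := fun i => f (dl I i))) // => i /=; rewrite lfunE.
Qed.

(** * The symmetric power of a form through a diagonalization *)

(** The exponent vectors of the monomials, in the order in which symseq lists
    their values. *)
Fixpoint exponents (m : nat) : nat -> seq (seq nat) :=
  if m is m'.+1 then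
    fix exponents_m k :=
      if k is k'.+1 then
        [seq 0%N :: e | e <- exponents m' k'.+1] ++
        [seq incr_nth e 0 | e <- exponents_m k']
      else [seq 0%N :: e | e <- exponents m' 0]
  else fun k => nseq (k == 0) [::].

Lemma exponentsS m k :
  exponents m.+1 k.+1 = [seq 0%N :: e | e <- exponents m k.+1] ++
                        [seq incr_nth e 0 | e <- exponents m.+1 k].
Proof. by []. Qed.

Lemma exponents0 m : exponents m.+1 0 = [seq 0%N :: e | e <- exponents m 0].
Proof. by []. Qed.

Lemma mem_exponents m k (e : seq nat) :
  (e \in exponents m k) = (size e == m) && (sumn e == k).
Proof.
have cons0 (s : seq (seq nat)) d : (0%N :: d \in [seq 0%N :: x | x <- s]) =
  (d \in s).
  by rewrite mem_map // => x y [].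
have consS (s : seq (seq nat)) i d : (i.+1 :: d \in [seq 0%N :: x | x <- s]) =
  false.
  by apply/mapP=> -[].
have nil0 (s : seq (seq nat)) : ([::] \in [seq 0%N :: x | x <- s]) = false.
  by apply/mapP=> -[].
elim: m k e => [|m IHm] k e.
  by case: k e => [|k] [|i e]; rewrite //= inE.
elim: k e => [|k IHk] [|[|i] e]; rewrite ?exponents0 ?exponentsS ?mem_cat ?nil0
  ?cons0 ?consS /=.
- by [].
- by rewrite IHm.
- by rewrite andbF.
- by apply/mapP=> -[[|]].
- rewrite IHm [X in _ || X](_ : _ = false) ?orbF //.
  by apply/mapP=> -[[|j d]].
- transitivity ((i :: e) \in exponents m.+1 k); last by rewrite IHk.
  apply/mapP/idP => [[[|j d]]|ie]; last by exists (i :: e).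
    by rewrite (IHk [::]).
  by move=> ? [-> ->].
Qed.

Lemma uniq_exponents m k : uniq (exponents m k).
Proof.
elim: m k => [|m IHm] k; first by case: k.
elim: k => [|k IHk]; first by rewrite /= map_inj_uniq // => x y [].
rewrite exponentsS cat_uniq map_inj_uniq ?IHm; last by move=> x y [].
rewrite map_inj_in_uniq ?IHk ?andbT ?andTb; last first.
  move=> [|i d] [|j d']; rewrite !mem_exponents //= => _ _.
  by case=> -> ->.
apply/hasPn => _ /mapP[[|i d] + ->]; first by rewrite mem_exponents.
by move=> _; apply/mapP=> -[].
Qed.

Definition monomial_value (R : nzRingType) (s : seq R) (e : seq nat) : R :=
  \prod_(p <- zip s e) p.1 ^+ p.2.

Lemma symseq_exponents (R : nzRingType) (s : seq R) k :
  symseq s k = [seq monomial_value s e | e <- exponents (size s) k].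
Proof.
rewrite /monomial_value; elim: s k => [|x s IHs] k.
  by case: k => //=; rewrite big_nil.
have map0 j : [seq \prod_(p <- zip (x :: s) e) p.1 ^+ p.2
                | e <- [seq 0%N :: e | e <- exponents (size s) j]] = symseq s j.
  rewrite -map_comp IHs; apply: eq_map => e.
  by rewrite /= big_cons expr0 mul1r.
elim: k => [|k IHk]; first exact: esym (map0 0%N).
rewrite [exponents _ _]exponentsS map_cat map0 symseqS IHk -!map_comp.
congr (_ ++ _); apply/eq_in_map => -[|i e]; rewrite mem_exponents //= => _.
by rewrite !big_cons exprS mulrA.
Qed.

Lemma perm_codom_monomial (K : fieldType) m k (c : 'I_m -> K) :
  perm_eq (codom (fun e : monomial m k => \prod_i c i ^+ val e i))
          (symseq (codom c) k).
Proof.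
pose w (e : monomial m k) := [seq val (val e i) | i <- enum 'I_m].
have wP : perm_eq [seq w e | e <- enum (monomial m k)] (exponents m k).
  apply: uniq_perm; rewrite ?uniq_exponents //.
    rewrite map_inj_uniq ?enum_uniq // => e e' /eq_in_map ee'.
    apply/val_inj/ffunP => i; apply/val_inj.
    by apply: ee'; rewrite mem_enum.
  move=> d; rewrite mem_exponents; apply/mapP/andP =>
    [[e _ ->]|[/eqP szd /eqP sd]].
    rewrite size_map size_enum_ord eqxx sumnE big_map big_enum; split=> //.
    by case: e => e eP; exact: eP.
  have dle i : (nth 0%N d i < k.+1)%N.
    rewrite ltnS -sd; have [id|id] := ltnP i (size d);
      last by rewrite nth_default.
    by rewrite sumnE (big_nth 0%N) big_mkord (bigD1 (Ordinal id)) //= leq_addr.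
  pose f : {ffun 'I_m -> 'I_k.+1} := [ffun i : 'I_m => inord (nth 0%N d i)].
  have fE i : val (f i) = nth 0%N d i by rewrite ffunE; apply: inordK.
  have fP : (\sum_i f i == k)%N.
    apply/eqP; rewrite -[RHS]sd sumnE (big_nth 0%N) big_mkord szd.
    by apply: eq_bigr => i _; apply: fE.
  exists (exist _ f fP : monomial m k); first by rewrite mem_enum.
  apply: (@eq_from_nth _ 0%N); first by rewrite size_map size_enum_ord.
  move=> i; rewrite szd => im; rewrite (nth_map (Ordinal im)) ?size_enum_ord
    //=.
  by rewrite fE nth_enum_ord.
rewrite symseq_exponents size_codom card_ord.
apply: perm_trans (perm_map (monomial_value (codom c)) wP).
rewrite -map_comp codomE; set u := map _ _; set v := map _ _.
suff -> : u = v by [].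
apply: eq_map => e /=; rewrite /monomial_value codomE /w zip_map big_map
  big_enum.
by [].
Qed.

(** The diagonalization hidden in the definition of the symmetric power is
    unspecified, but it is chain equivalent to any given one. *)
Lemma isometric_sym_power (K : fieldType) (V : vectType K) (q : V -> K) k
    (I J : finType) (c0 : I -> K) (c1 : J -> K) :
  2%:R != 0 :> K -> (forall i, c0 i != 0) -> isometric q (diag_form c0) ->
  \dim {:V} = #|I| -> perm_eq (codom c1) (symseq (codom c0) k) ->
  isometric (sym_power k q) (diag_form c1).
Proof.
move=> char2 c00 qc0 dimV c1P.
rewrite /sym_power; set c := classical_sets.xget _ _.
have [nz_c qc] : diagonalizes q c.
  apply: classical_sets.xgetPex.
  pose h (i : 'I_(\dim {:V})) : I := enum_val (cast_ord dimV i).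
  have hB : bijective h.
    by apply: inj_card_bij; [move=> i j /enum_val_inj/cast_ord_inj|rewrite
      card_ord dimV].
  exists [ffun i => c0 (h i)]; split; first by move=> i; rewrite ffunE.
  apply: isometric_trans qc0 _; apply: isometric_trans (isometric_reindex _ hB)
    _.
  by apply: eq_diag_form => i; rewrite ffunE.
have c_c0 : chain (codom c) (codom c0).
  apply: chain_isometric => //; exact: isometric_trans (isometric_sym qc) qc0.
have sc := chain_symseq k c_c0.
(* Composing with the enumeration of the monomials in the definition. *)
have scI := chain_isoseq (chain_trans (chain_perm (perm_codom_monomial k c))
  sc).
apply: isometric_trans _ (isometric_trans scI _).
  by apply: isometric_perm; rewrite codom_in_tuple.
by apply: isometric_perm; rewrite codom_in_tuple perm_sym.
Qed.

(** * Symmetric powers of forms with coefficients 1 and -1 *)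

Definition hyp_signs (R : pzRingType) (p : nat) : seq R :=
  flatten (nseq p [:: 1; -1]).

Lemma sum_symseqS (R : pzRingType) x (s : seq R) k :
  \sum_(y <- symseq (x :: s) k.+1) y =
    \sum_(y <- symseq s k.+1) y + x * \sum_(y <- symseq (x :: s) k) y.
Proof. by rewrite symseqS big_cat big_map mulr_sumr. Qed.

(** The two factors of the generating series multiply to 1/(1 - t^2):
    adjoining a hyperbolic plane sums the series over degrees of the same
    parity. *)
Lemma sum_symseq_hyp (R : pzRingType) (s : seq R) k :
  \sum_(y <- symseq [:: 1, -1 & s] k.+2) y =
    \sum_(y <- symseq s k.+2) y + \sum_(y <- symseq [:: 1, -1 & s] k) y.
Proof.
rewrite !sum_symseqS mulN1r !mul1r -addrA; congr (_ + _).
by rewrite -mulN1r addrA mulN1r addNr add0r.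
Qed.

(** The coefficient of t^k in 1/((1 - d t)(1 - t^2)^p), where d is a sign;
    the induction step is Pascal's rule. *)
Lemma sum_symseq_signs (d : int) p k : d ^+ 2 = 1 ->
  \sum_(y <- symseq (hyp_signs int p ++ [:: d]) k) y =
    d ^+ k *+ 'C(p + k./2, k./2).
Proof.
move=> d2; elim: p k => [|p IHp] k.
  rewrite binn mulr1n; elim: k => [|k IHk]; first by rewrite symseq0 big_seq1.
  by rewrite sum_symseqS IHk /= big_nil add0r exprS.
rewrite -[hyp_signs _ _ ++ _]/[:: 1, -1 & hyp_signs int p ++ [:: d]].
elim/nat_ind2: k => [||k IHk].
- by rewrite symseq0 big_seq1 bin0.
- by rewrite !sum_symseqS (IHp 1) !symseq0 !big_seq1 [1./2]/= !bin0; ring.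
rewrite sum_symseq_hyp IHp IHk exprSr exprSr -mulrA -expr2 d2 mulr1 -mulrnDr.
by congr (_ *+ _); rewrite /= !addSn !addnS [RHS]binS.
Qed.

Lemma perm_hyp_signs (R : pzRingType) h :
  perm_eq (hyp_signs R h) (nseq h 1 ++ nseq h (-1)).
Proof.
elim: h => //= h IHh; rewrite perm_cons.
by rewrite (perm_trans _ (permEl (perm_catCA [:: -1] _ _))) //= perm_cons.
Qed.

(** With p entries 1 and m entries -1 the length is p + m and the sum is p -
    m, so they determine the list up to permutation. *)
Lemma signs_normal_form (d : int) (u : seq int) r :
  d ^+ 2 = 1 -> all (fun y => y ^+ 2 == 1) u -> \sum_(y <- u) y = d *+ r ->
  exists h, (r + 2 * h)%N = size u /\ perm_eq u (nseq r d ++ hyp_signs int h).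
Proof.
move=> d2 u1 ud.
have sgn (y : int) : y ^+ 2 = 1 -> y = 1 \/ y = -1.
  by move=> /eqP; rewrite sqrf_eq1 => /orP[]/eqP; [left|right].
have [p [m upm]] : exists p m, perm_eq u (nseq p 1 ++ nseq m (-1)).
  elim: u u1 {ud} => [|y u IHu] /=; first by exists 0, 0.
  case/andP=> /eqP/sgn[]-> /IHu[p [m upm]].
    by exists p.+1, m; rewrite perm_cons.
  exists p, m.+1; rewrite perm_sym; apply: perm_trans (permEl (perm_catCA _ [::
    -1] _)) _.
  by rewrite /= perm_cons perm_sym.
have sum_nseq n (y : int) : \sum_(z <- nseq n y) z = y *+ n.
  by rewrite big_nseq; elim: n => //= n ->; rewrite mulrS.
move: ud; rewrite (perm_big _ upm) big_cat /= !sum_nseq (perm_size upm).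
rewrite size_cat !size_nseq.
case/sgn: d2 => -> ud.
  have Dp : p = (r + m)%N by lia.
  exists m; split; first by lia.
  apply: perm_trans upm _; rewrite Dp nseqD -catA perm_cat2l perm_sym.
  exact: perm_hyp_signs.
have Dm : m = (r + p)%N by lia.
exists p; split; first by lia.
apply: perm_trans upm _; rewrite Dm nseqD perm_catCA perm_cat2l perm_sym.
exact: perm_hyp_signs.
Qed.

Lemma codom_copies (R : Type) (I : finType) (c : I -> R) r :
  codom (fun i : 'I_r * I => c i.2) = flatten (nseq r (codom c)).
Proof.
rewrite /codom /image_mem enumT unlock /= /prod_enum map_flatten -map_comp.
rewrite -[in RHS](size_enum_ord r) !enumT; congr flatten.
by elim: (Finite.enum 'I_r) => //= i e ->; rewrite -map_comp.
Qed.

Lemma isometric_signs (K : fieldType) (d : K) r h :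
  isometric (diag_form (tnth (in_tuple (nseq r d ++ hyp_signs K h))))
    (perp (copies r (unary_form d)) (copies h (hyperbolic_plane K))).
Proof.
have H := isometric_perp (isometric_copies (tnth [tuple d]) r)
                         (isometric_copies (tnth [tuple (1 : K); -1]) h).
apply: isometric_sym; apply: isometric_trans H _.
apply: isometric_trans (isometric_sum _ _) _; apply: isometric_perm.
rewrite codom_in_tuple /codom /image_mem enumT unlock /= /sum_enum map_cat
  -!map_comp.
set u := map _ _; set v := map _ _.
have -> : u = flatten (nseq r [:: d]).
  have := codom_copies (tnth [tuple d]) r; rewrite codom_tnth => <-.
  by rewrite /u codomE enumT.
have -> : v = hyp_signs K h.
  have := codom_copies (tnth [tuple (1 : K); -1]) h; rewrite codom_tnth.
  by rewrite /hyp_signs => <-; rewrite /v codomE enumT.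
rewrite perm_cat2r; set w := flatten _; suff -> : w = nseq r d by [].
by rewrite /w; elim: r {u v w} => //= r ->.
Qed.

(** The coefficients are images of integers, so that they can be counted by
    summing in the integers, whatever the characteristic of K. *)
Lemma isometric_symseq_signs (K : fieldType) (d : int) p k
    (r := 'C(p + k./2, k./2)) :
  d ^+ 2 = 1 ->
  exists h, (r + 2 * h = 'C(p.*2.+1 + k - 1, k))%N /\
    isometric
      (diag_form (tnth (in_tuple (symseq (hyp_signs K p ++ [:: d%:~R]) k))))
      (perp (copies r (unary_form (d ^+ k)%:~R))
            (copies h (hyperbolic_plane K))).
Proof.
move=> d2; pose s := hyp_signs int p ++ [:: d].
have dk2 : (d ^+ k) ^+ 2 = 1 by rewrite exprAC d2 expr1n.
have sK : map intr s = hyp_signs K p ++ [:: d%:~R].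
  by rewrite map_cat map_flatten map_nseq.
have s1 : all (fun y => y ^+ 2 == 1) s.
  rewrite all_cat /= d2 eqxx !andbT; apply/allP => y /flattenP[t].
  by rewrite mem_nseq => /andP[_ /eqP->]; rewrite !inE => /orP[]/eqP->.
have sk1 : all (fun y => y ^+ 2 == 1) (symseq s k).
  elim: (s) s1 k {r dk2} => [|x t IHt] /=; first by move=> _ [].
  case/andP=> /eqP x1 /IHt{}IHt; elim=> [|k IHk]; first exact: IHt.
  rewrite all_cat IHt all_map; apply/allP => y yk /=.
  by rewrite exprMn x1 mul1r; apply: (allP IHk).
have := signs_normal_form dk2 sk1; rewrite sum_symseq_signs // =>
  /(_ _ erefl)[h [sz su]].
exists h; split.
  rewrite sz size_symseq size_cat size_flatten /shape map_nseq sumn_nseq /=.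
  by congr 'C(_, _); lia.
rewrite -sK -map_symseq; apply: isometric_trans (isometric_signs _ _ _).
apply: isometric_perm; rewrite !codom_in_tuple.
apply: perm_trans (perm_map _ su) _.
by rewrite map_cat map_nseq /hyp_signs map_flatten map_nseq.
Qed.

(** * Roots of unity *)

Lemma prim_root_neq0 (K : fieldType) n (w : K) : n.-primitive_root w -> w != 0.
Proof.
move=> w_prim; apply/eqP => w0; have /eqP := prim_expr_order w_prim.
by rewrite w0 expr0n gtn_eqF ?(prim_order_gt0 w_prim) // eq_sym oner_eq0.
Qed.

Lemma prod_1subX_prim_root (K : fieldType) n (w : K) :
  n.-primitive_root w -> \prod_(1 <= i < n) (1 - w ^+ i) = n%:R.
Proof.
move=> w_prim; have n_gt0 := prim_order_gt0 w_prim.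
have := factor_Xn_sub_1 w_prim; rewrite big_ltn // expr0 polyC1.
rewrite -[X in _ = _ - X](expr1n {poly K} n) subrXX.
have X1 : 'X - 1 != 0 :> {poly K} by rewrite -polyC1 polyXsubC_eq0.
move/(mulfI X1)/(congr1 (horner^~ 1)); rewrite horner_prod horner_sum => E.
transitivity (\prod_(1 <= i < n) ('X - (w ^+ i)%:P).[1]).
  by apply: eq_bigr => i _; rewrite hornerXsubC.
rewrite E (eq_bigr (fun=> 1)) => [|i _].
  by rewrite sumr_const card_ord.
by rewrite expr1n mulr1 hornerXn expr1n.
Qed.

Lemma prim_root_natf_neq0 (K : fieldType) n (w : K) :
  n.-primitive_root w -> n%:R != 0 :> K.
Proof.
move=> w_prim; rewrite -(prod_1subX_prim_root w_prim) big_seq.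
rewrite prodf_seq_neq0; apply/allP => i; rewrite mem_index_iota =>
  /andP[i0 ilt].
apply/implyP => _; rewrite subr_eq0 eq_sym -(prim_order_dvd w_prim).
by rewrite gtnNdvd.
Qed.

(** In the product of the 1 - w^i, the factors of index i and n - i multiply
    to - w^(-i) (1 - w^i)^2. The square root of w is z = w^((n+1)/2). *)
Lemma natr_prim_root_sqr (K : fieldType) n (w : K) : odd n ->
  n.-primitive_root w -> exists s : K, n%:R = (-1) ^+ (n - 1)./2 * s ^+ 2.
Proof.
move=> n_odd w_prim; set h := (n - 1)./2.
have Dn : n = h.*2.+1 by rewrite /h; lia.
pose z := w ^+ h.+1; have z2 : z ^+ 2 = w.
  by rewrite -exprM muln2 doubleS -Dn exprS (prim_expr_order w_prim) mulr1.
have wn : w ^+ n = 1 := prim_expr_order w_prim.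
have w0 := prim_root_neq0 w_prim.
have z0 : z != 0 by rewrite expf_neq0.
exists (\prod_(1 <= i < h.+1) (z ^- i * (1 - w ^+ i))).
rewrite -(prod_1subX_prim_root w_prim) (big_cat_nat (n := h.+1)) //=;
  last by lia.
have -> : \prod_(h.+1 <= i < n) (1 - w ^+ i) =
          \prod_(1 <= i < h.+1) (1 - w ^+ (n - i)).
  rewrite big_nat_rev /= -{1}[h.+1]add1n big_addn.
  have -> : (n - h = h.+1)%N by lia.
  apply: eq_big_nat => i ih; congr (1 - w ^+ _); lia.
rewrite -prodrXl -big_split /=.
have -> : (-1 : K) ^+ h = \prod_(1 <= i < h.+1) -1.
  by rewrite prodr_const_nat subn1.
rewrite -big_split /=; apply: eq_big_nat => i /andP[_ ih].
have -> : w ^+ (n - i) = (z ^- i) ^+ 2.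
  by rewrite exprVn exprAC z2 exprB ?wn ?unitfE ?div1r //; lia.
have -> : w ^+ i = z ^+ i ^+ 2 by rewrite exprAC z2.
have zi0 : z ^+ i != 0 by rewrite expf_neq0.
by field.
Qed.

Lemma sum_unity_root (K : fieldType) n (z : K) :
  z ^+ n = 1 -> \sum_(i < n) z ^+ i = if z == 1 then n%:R else 0.
Proof.
move=> zn; have [->|z1] := eqVneq z 1.
  rewrite (eq_bigr (fun=> 1)) ?sumr_const ?card_ord // => i _; exact: expr1n.
apply: (mulfI (x := z - 1)); first by rewrite subr_eq0.
by rewrite -subrX1 zn subrr mulr0.
Qed.

(** * Monomials in the generators of a symbol algebra *)

Section SymbolBasis.
Variables (K : fieldType) (m : nat) (w a b : K).
Let n := m.+1.
Hypothesis w_prim : n.-primitive_root w.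
Hypotheses (a0 : a != 0) (b0 : b != 0).
Variables (A : algType K) (x y : A).
Hypotheses (xn : x ^+ n = a%:A) (yn : y ^+ n = b%:A).
Hypothesis yx : y * x = w *: (x * y).

Lemma symbol_commX i j : y ^+ j * x ^+ i = w ^+ (i * j) *: (x ^+ i * y ^+ j).
Proof.
have y1 j' : y ^+ j' * x = w ^+ j' *: (x * y ^+ j').
  elim: j' => [|j' IH]; first by rewrite !expr0 scale1r mul1r mulr1.
  by rewrite exprSr -mulrA yx -scalerAr (mulrA _ x y) IH -scalerAl scalerA
    -exprS -mulrA.
elim: i => [|i IH]; first by rewrite mul0n !expr0 scale1r mul1r mulr1.
rewrite exprSr mulrA IH -scalerAl -(mulrA (x ^+ i) (y ^+ j)) y1 -scalerAr
  scalerA.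
by rewrite mulrA -exprD mulSn addnC.
Qed.

Definition symbol_mon (i j : nat) : A := x ^+ i * y ^+ j.

Lemma symbol_monM i j k l :
  symbol_mon i j * symbol_mon k l = w ^+ (k * j) *: symbol_mon (i + k) (j + l).
Proof.
rewrite /symbol_mon mulrA -(mulrA (x ^+ i)) symbol_commX -scalerAr -scalerAl.
by rewrite mulrA -exprD -mulrA -exprD.
Qed.

Lemma symbol_mon_mod i j :
  symbol_mon i j = (a ^+ (i %/ n) * b ^+ (j %/ n)) *: symbol_mon (i %% n) (j %%
    n).
Proof.
rewrite /symbol_mon {1}(divn_eq i n) {1}(divn_eq j n) !exprD.
rewrite ![(_ * n)%N]mulnC !exprM xn yn !exprZn !expr1n.
by rewrite !mulr_algl -scalerAl -scalerAr scalerA.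
Qed.

Definition symbol_elt (p : 'I_n * 'I_n) : A := symbol_mon p.1 p.2.

Lemma symbol_elt_neq0 p : symbol_elt p != 0.
Proof.
apply/eqP => p0; have /eqP : x ^+ (n - p.1) * symbol_elt p * y ^+ (n - p.2) = 0.
  by rewrite p0 mulr0 mul0r.
rewrite /symbol_elt /symbol_mon mulrA -exprD -mulrA -exprD.
rewrite !subnK ?(ltnW (ltn_ord _)) // subnKC ?(ltnW (ltn_ord _)) // xn yn.
by rewrite -scalerAl mul1r scalerA scaler_eq0 oner_eq0 orbF mulf_eq0 (negPf a0)
  (negPf b0).
Qed.

Let wX i : (w ^+ i) ^+ n = 1.
Proof. by rewrite exprAC (prim_expr_order w_prim) expr1n. Qed.

Let w0 : w != 0.
Proof. exact: prim_root_neq0 w_prim. Qed.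

Let w_subC i j : (i <= n)%N -> (j <= n)%N ->
  w ^+ ((n - i) * j) = w ^+ ((n - j) * i).
Proof.
move=> le_i le_j; apply: (mulfI (expf_neq0 (i * j) w0)).
rewrite -!exprD mulnBl mulnBl subnKC ?leq_mul2r ?le_i ?orbT //.
by rewrite (mulnC i) subnKC ?leq_mul2r ?le_j ?orbT // !exprM !(prim_expr_order
  w_prim) !expr1n.
Qed.

Let sum_w (i q : 'I_n) : \sum_(t < n) (w ^+ (n - q + i)) ^+ t =
  n%:R *+ (i == q).
Proof.
rewrite sum_unity_root ?wX // -(prim_order_dvd w_prim).
have -> : (n %| n - q + i)%N = (i == q).
  apply/idP/eqP => [|->]; last by rewrite subnK // ltnW.
  case/dvdnP => k Dk; apply: val_inj => /=; have := ltn_ord i;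
    have := ltn_ord q.
  by case: k Dk => [|[|k]]; rewrite ?mulSn; lia.
by case: eqP.
Qed.

(** Conjugation by y^t, written without inverses thanks to y^n = b: it
    multiplies x^i by w^(i t). *)
Lemma symbol_elt_conjY t p : (t <= n)%N ->
  y ^+ t * symbol_elt p * y ^+ (n - t) = (b * w ^+ (p.1 * t)) *: symbol_elt p.
Proof.
move=> le_t; rewrite /symbol_elt /symbol_mon (mulrA (y ^+ t)) symbol_commX
  -!scalerAl.
rewrite -(mulrA (x ^+ p.1)) -exprD -(mulrA (x ^+ p.1)) -exprD addnAC subnKC //.
by rewrite exprD yn mulr_algl -scalerAr scalerA mulrC.
Qed.

Lemma symbol_elt_conjX s p : (s <= n)%N ->
  x ^+ s * symbol_elt p * x ^+ (n - s) = (a * w ^+ ((n - s) * p.2)) *: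
    symbol_elt p.
Proof.
move=> le_s; rewrite /symbol_elt /symbol_mon mulrA -exprD -mulrA symbol_commX
  -scalerAr.
rewrite mulrA -exprD addnAC subnKC // exprD xn mulr_algl -scalerAl scalerA.
by rewrite mulrC.
Qed.

(** Averaging the conjugates by x^s y^t against a character isolates one
    coefficient: the monomials are eigenvectors for distinct characters. *)
Lemma symbol_elt_conj (q : 'I_n * 'I_n) (c : 'I_n * 'I_n -> K) :
  \sum_(s < n) \sum_(t < n) (w ^+ ((n - q.1) * t) * w ^+ (q.2 * s)) *:
    (x ^+ s * (y ^+ t * (\sum_p c p *: symbol_elt p) * y ^+ (n - t)) * x ^+ (n
      - s)) =
  (a * b * n%:R ^+ 2 * c q) *: symbol_elt q.
Proof.
have term (s t : 'I_n) p :
    x ^+ s * (y ^+ t * symbol_elt p * y ^+ (n - t)) * x ^+ (n - s) =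
    (a * b * (w ^+ (p.1 * t) * w ^+ ((n - s) * p.2))) *: symbol_elt p.
  rewrite symbol_elt_conjY ?(ltnW (ltn_ord t)) // -scalerAr -scalerAl.
  rewrite symbol_elt_conjX ?(ltnW (ltn_ord s)) // scalerA.
  by congr (_ *: _); ring.
pose f (s t : 'I_n) (p : 'I_n * 'I_n) := (w ^+ ((n - q.1) * t) * w ^+ (q.2 *
  s)) *
   (a * b * (w ^+ (p.1 * t) * w ^+ ((n - s) * p.2))) * c p.
transitivity (\sum_p (\sum_(s < n) \sum_(t < n) f s t p) *: symbol_elt p).
  under [RHS]eq_bigr => p _.
    rewrite scaler_suml; under eq_bigr => s _ do rewrite scaler_suml; over.
  rewrite [RHS]exchange_big; apply: eq_bigr => s _; rewrite [RHS]exchange_big.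
  apply: eq_bigr => t _; rewrite mulr_sumr mulr_suml mulr_sumr mulr_suml
    scaler_sumr.
  apply: eq_bigr => p _; rewrite /f -!scalerAr -!scalerAl -scalerAr -scalerAl
    term !scalerA.
  by congr (_ *: _); ring.
have sumf p : \sum_(s < n) \sum_(t < n) f s t p =
    a * b * c p * ((n%:R *+ (p.1 == q.1)) * (n%:R *+ (q.2 == p.2))).
  rewrite -!sum_w big_distrlr /= [in RHS]exchange_big mulr_sumr;
    apply: eq_bigr => s _.
  rewrite mulr_sumr; apply: eq_bigr => t _; rewrite /f (@w_subC s p.2) ?(ltnW
    (ltn_ord _)) //.
  by rewrite -!exprM !mulnDl !exprD; ring.
rewrite (bigD1 q) //= sumf !eqxx big1 => [|p pq]; last first.
  rewrite sumf; have : ~~ ((p.1 == q.1) && (q.2 == p.2)).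
    by apply: contra pq => /andP[/eqP e1 /eqP e2];
      case: (p) (q) e1 e2 => ? ? [? ?] /= -> ->.
  by rewrite negb_and => /orP[]/negPf->; rewrite mulr0n ?mul0r !mulr0 scale0r.
by rewrite addr0 !mulr1n; congr (_ *: _); ring.
Qed.

(** Applying these averages to a vanishing combination isolates its
    coefficients, in any algebra with these relations: the symbol algebra and
    matrix algebras alike. *)
Lemma symbol_elt_free (c : 'I_n * 'I_n -> K) :
  \sum_p c p *: symbol_elt p = 0 -> forall p, c p = 0.
Proof.
move=> c0 p; have /eqP := symbol_elt_conj p c; rewrite c0.
rewrite big1 => [|s _]; last first.
  by rewrite big1 // => t _; rewrite mulr0 mul0r mulr0 mul0r scaler0.
rewrite eq_sym scaler_eq0 (negPf (symbol_elt_neq0 p)) orbF !mulf_eq0.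
by rewrite (negPf a0) (negPf b0) !(negPf (prim_root_natf_neq0 w_prim)) /= =>
  /eqP.
Qed.

End SymbolBasis.

(** * The monomial basis and its traces *)

Section SymbolCoords.
Variables (K : fieldType) (m : nat) (w a b : K).
Let n := m.+1.
Hypothesis w_prim : n.-primitive_root w.
Hypotheses (a0 : a != 0) (b0 : b != 0).
Variables (A : falgType K) (x y : A).
Hypotheses (xn : x ^+ n = a%:A) (yn : y ^+ n = b%:A).
Hypothesis yx : y * x = w *: (x * y).

Local Notation e := (@symbol_elt K m A x y).

Definition symbol_basis : (#|{: 'I_n * 'I_n}|).-tuple A :=
  [tuple of [seq e p | p <- enum_tuple {: 'I_n * 'I_n}]].

Lemma nth_symbol_basis (i : 'I_#|{: 'I_n * 'I_n}|) : symbol_basis`_i =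
  e (enum_val i).
Proof.
rewrite (nth_map (enum_val i)) ?size_enum // -?cardE //.
by congr (e _); rewrite [RHS](enum_val_nth (enum_val i)).
Qed.

Lemma symbol_basis_free : free symbol_basis.
Proof.
apply/freeP => k k0 i.
pose c p := k (enum_rank p); rewrite -(enum_valK i) -/(c _).
apply: (symbol_elt_free w_prim a0 b0 xn yn yx).
rewrite -[RHS]k0 (reindex _ (onW_bij _ (enum_val_bij _))) /=.
by apply: eq_bigr => j _; rewrite nth_symbol_basis /c enum_valK.
Qed.

Hypothesis gen_xy : <<<<[:: x; y]>>%VS>>%AS = fullv :> {vspace A}.

Lemma mem_symbol_basis i j : symbol_mon x y i j \in <<symbol_basis>>%VS.
Proof.
have ilt k : (k %% n < n)%N by rewrite ltn_mod.
rewrite (symbol_mon_mod xn yn) memvZ // memv_span //; apply/mapP.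
by exists (Ordinal (ilt i), Ordinal (ilt j)) => //; rewrite mem_enum.
Qed.

(** The span of the reduced monomials contains 1 and is stable under left
    multiplication by both generators. *)
Lemma symbol_basisP : basis_of fullv symbol_basis.
Proof.
rewrite /basis_of symbol_basis_free andbT eqEsubv subvf -gen_xy /=.
apply: agenv_sub_modl.
  by rewrite -memvE -[1](mulr1 1); apply: (mem_symbol_basis 0 0).
apply/prodvP => u v; rewrite span_cons span_seq1.
case/memv_addP => _ /vlineP[c ->] [_ /vlineP[d ->] ->] Vv.
have stable z : (forall p, z * e p \in <<symbol_basis>>%VS) ->
  z * v \in <<symbol_basis>>%VS.
  move=> zV; suff /subvP/(_ v Vv): (<<symbol_basis>> <= amull z @^-1:
    <<symbol_basis>>)%VS.
    by rewrite -memv_preim lfunE.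
  by apply/span_subvP => _ /mapP[p _ ->]; rewrite -memv_preim lfunE; apply: zV.
rewrite mulrDl -!scalerAl memvD // memvZ // stable // => p.
  by rewrite /symbol_elt /symbol_mon mulrA -exprS; apply: mem_symbol_basis.
rewrite /symbol_elt /symbol_mon mulrA -[y]expr1 (symbol_commX yx) expr1
  -scalerAl memvZ //.
by rewrite -mulrA -exprS; apply: mem_symbol_basis.
Qed.

Definition symbol_coord (z : A) : {ffun 'I_n * 'I_n -> K^o} :=
  [ffun p => coord symbol_basis (enum_rank p) z].

Lemma symbol_coord_elt p q : symbol_coord (e p) q = (p == q)%:R.
Proof.
rewrite ffunE -[in LHS](enum_rankK p) -nth_symbol_basis coord_free
  ?symbol_basis_free //.
by rewrite (inj_eq enum_rank_inj).
Qed.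

Definition symbol_comb (v : {ffun 'I_n * 'I_n -> K^o}) : A :=
  \sum_p (v p : K) *: e p.

Lemma symbol_coordK : cancel symbol_coord symbol_comb.
Proof.
move=> z; rewrite [RHS](coord_basis symbol_basisP (memvf z)).
rewrite /symbol_comb (reindex _ (onW_bij _ (enum_val_bij _))) /=.
by apply: eq_bigr => j _; rewrite nth_symbol_basis ffunE enum_valK.
Qed.

Lemma symbol_comb_linear : linear symbol_comb.
Proof.
move=> c u v; rewrite /symbol_comb scaler_sumr -big_split /=.
by apply: eq_bigr => p _; rewrite !ffunE scalerDl scalerA.
Qed.

Lemma symbol_combK : cancel symbol_comb symbol_coord.
Proof.
move=> v; apply/ffunP => p; apply/eqP; rewrite -subr_eq0; apply/eqP.
apply: (symbol_elt_free w_prim a0 b0 xn yn yx (c :=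
  fun p => (symbol_coord (symbol_comb v) p - v p : K))).
under eq_bigr => q _ do rewrite scalerBl.
by rewrite sumrB -[X in X - _ = _]/(symbol_comb _) symbol_coordK subrr.
Qed.

Lemma dim_symbol : \dim {:A} = (n ^ 2)%N.
Proof. by rewrite (size_basis symbol_basisP) card_prod !card_ord mulnn. Qed.

End SymbolCoords.

Section SymbolTrace.
Variables (K : fieldType) (m : nat) (w a b : K).
Let n := m.+1.
Hypothesis w_prim : n.-primitive_root w.
Hypotheses (a0 : a != 0) (b0 : b != 0).
Variables (d : nat) (x y : 'M[K]_d.+1).
Hypotheses (xn : x ^+ n = a%:A) (yn : y ^+ n = b%:A).
Hypothesis yx : y * x = w *: (x * y).

(** A trace is invariant under conjugation, and conjugation by y (resp. x)
    multiplies the monomial by w^i (resp. a power of w^j), which is not 1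
    unless the exponent vanishes. *)
Lemma mxtrace_symbol_elt (p : 'I_n * 'I_n) :
  \tr (symbol_elt x y p) = d.+1%:R *+ (p == 0).
Proof.
have [->|] := eqVneq p 0.
  by rewrite /symbol_elt /symbol_mon /= !expr0 mulr1 mxtrace1.
have -> : (p == 0) = (p.1 == 0) && (p.2 == 0) by case: p => i j;
  apply: xpair_eqE.
have tr_mulC (u v : 'M[K]_d.+1) : \tr (u * v) =
  \tr (v * u) by exact: mxtrace_mulC.
have wi (i : 'I_n) : i != 0 -> w ^+ i != 1.
  by move=> i0; rewrite -(prim_order_dvd w_prim) gtnNdvd // lt0n.
have trE0 c i : c != 0 -> i != 0 :> 'I_n ->
    c * \tr (symbol_elt x y p) = c * w ^+ i * \tr (symbol_elt x y p) ->
    \tr (symbol_elt x y p) = 0.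
  move=> c0 /wi wi1; rewrite -mulrA => /(mulfI c0)/eqP.
  rewrite -subr_eq0 -[X in X - _]mul1r -mulrBl mulf_eq0 subr_eq0 eq_sym (negPf
    wi1).
  by move/eqP.
rewrite negb_and mulr0n => /orP[] pi.
  apply: (trE0 b p.1 b0 pi); have := symbol_elt_conjY yn yx p (isT : 1 <= n)%N.
  move/(congr1 (@mxtrace _ _)); rewrite mxtraceZ muln1 => <-.
  by rewrite [RHS]tr_mulC mulrA -exprD subnK // yn mulr_algl mxtraceZ.
apply: (trE0 a p.2 a0 pi); have := symbol_elt_conjX xn yx p (leqnSn m).
move/(congr1 (@mxtrace _ _)); rewrite mxtraceZ subSnn mul1n => <-.
by rewrite [RHS]tr_mulC mulrA -exprD add1n xn mulr_algl mxtraceZ.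
Qed.

End SymbolTrace.

(** * A splitting by clock and shift matrices *)

Lemma irreducible_factor (K : fieldType) (p : {poly K}) : (1 < size p)%N ->
  exists2 q, irreducible_poly q & q %| p.
Proof.
elim: {p}(size p) {-2}p (leqnn (size p)) => [|s IHs] p sz_p p_gt1.
  by move: (leq_trans p_gt1 sz_p).
have [irr|] := boolp.pselect (irreducible_poly p); first by exists p.
move=> nirr; have [[q [q1 qp qNp]]|noq] :=
  boolp.pselect (exists q : {poly K}, [/\ size q != 1, q %| p & ~~ (q %= p)]).
  have p0 : p != 0 by rewrite -size_poly_gt0 ltnW.
  have q0 : q != 0 by apply: contraTneq qp => ->; rewrite dvd0p.
  have sqp : (size q < size p)%N.
    by rewrite ltn_neqAle dvdp_leq // dvdp_size_eqp // qNp.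
  have [||r r_irr rq] := IHs q.
  - by rewrite -ltnS (leq_trans sqp).
  - by rewrite ltn_neqAle eq_sym q1 size_poly_gt0.
  by exists r; last exact: dvdp_trans rq qp.
case: nirr; split=> // q q1 qp; apply/negPn/negP => qNp.
by case: noq; exists q.
Qed.

Lemma root_extension (K : fieldType) (p : {poly K}) : (1 < size p)%N ->
  exists (L : fieldType) (iota : {rmorphism K -> L}) (z : L),
    root (map_poly iota p) z.
Proof.
case/irreducible_factor=> q /irredp_FAdjoin[L _ [z qz _]] qp.
exists L, (GRing.in_alg L : {rmorphism K -> L}), z.
case/dvdpP: qp => r ->; by rewrite rmorphM rootM qz orbT.
Qed.

(** The clock matrix is z times the diagonal matrix of the powers of w. The
    shift matrix permutes the basis cyclically and multiplies by b when it
    passes the end, so that its t-th power multiplies by b as many times as i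
    + t wraps around. *)
Lemma clock_shift (L : fieldType) m (w b z : L) (n := m.+1) : w ^+ n = 1 ->
  exists x y : 'M[L]_m.+1,
    [/\ x ^+ n = (z ^+ n)%:A, y ^+ n = b%:A & y * x = w *: (x * y)].
Proof.
move=> wn.
pose x : 'M[L]_m.+1 := \matrix_(i, j) ((z * w ^+ i) *+ (i == j)).
pose y : 'M[L]_m.+1 :=
  \matrix_(i, j) (b ^+ ((i + 1) %/ n)%N *+ (j == (i + 1) %% n :> nat)%N).
have mulrM (c d : L) (e f : bool) : (c *+ e) * (d *+ f) = (c * d) *+ (e && f).
  by case: e f => [] []; rewrite ?mulr1n ?mulr0n ?mul0r ?mulr0.
have sum1 (F : 'I_n -> L) k (lt_k : (k < n)%N) :
    \sum_j F j *+ (j == k :> nat) = F (Ordinal lt_k).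
  rewrite (bigD1 (Ordinal lt_k)) //= eqxx big1 ?addr0 // => j jk.
  by rewrite [_ == _](_ : _ = false) //; apply: contraNF jk => /eqP jk;
    apply/eqP/val_inj.
have xX t i j : (x ^+ t) i j = (z * w ^+ i) ^+ t *+ (i == j).
  elim: t i j => [|t IHt] i j; first by rewrite !expr0 mxE.
  rewrite exprSr -mulmxE mxE (bigD1 i) //= big1 => [|k ki]; last first.
    by rewrite IHt eq_sym (negPf ki) mulr0n mul0r.
  by rewrite IHt mxE eqxx mulrM addr0 exprSr.
have yX t i j : (y ^+ t) i j = b ^+ ((i + t) %/ n)%N *+ (j == (i + t) %% n :>
  nat)%N.
  elim: t i j => [|t IHt] i j.
    by rewrite expr0 mxE addn0 divn_small ?modn_small // eq_sym.
  rewrite exprSr -mulmxE mxE.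
  under eq_bigr => k _ do rewrite IHt mulrnAl.
  rewrite (sum1 (fun k => b ^+ ((i + t) %/ n)%N * y k j) _ (ltn_pmod (i + t)
    (ltn0Sn m))).
  rewrite mxE mulrnAr -exprD /= modnDml -addnA addn1; congr (b ^+ _ *+ _);
    last by rewrite addn1.
  by rewrite addnS [in RHS](divn_eq (i + t) n) -addnS divnMDl // addn1.
exists x, y; split; apply/matrixP => i j.
- rewrite xX exprMn exprAC wn expr1n mulr1 !mxE.
  by case: eqP => _; rewrite ?mulr1 ?mulr0.
- rewrite yX divnDr // divnn divn_small // add0n expr1 modnDr modn_small //
  !mxE.
  by rewrite eq_sym; case: eqP => [/val_inj->|/eqP ij];
    rewrite ?eqxx ?mulr1 // -val_eqE (negPf ij) mulr0.
- rewrite -!mulmxE !mxE (bigD1 j) //= [in RHS](bigD1 i) //= !big1 => [|k|k].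
  + rewrite !addr0 !mxE !eqxx !mulr1n; case: eqP => [->|_]; last first.
      by rewrite mulr0n mul0r !mulr0.
    by rewrite expr_mod // addn1 exprS mulr1n; ring.
  + by rewrite !mxE eq_sym => /negPf->; rewrite mulr0n mul0r.
  + by rewrite !mxE => /negPf->; rewrite mulr0n mulr0.
Qed.

(** * The reduced trace of a symbol algebra *)

Section ReducedTrace.
Variables (K : fieldType) (m : nat) (w a b : K).
Let n := m.+1.
Hypothesis w_prim : n.-primitive_root w.
Hypotheses (a0 : a != 0) (b0 : b != 0).
Variables (S : falgType K) (x y : S).
Hypotheses (xn : x ^+ n = a%:A) (yn : y ^+ n = b%:A).
Hypothesis yx : y * x = w *: (x * y).
Hypothesis gen_xy : <<<<[:: x; y]>>%VS>>%AS = fullv :> {vspace S}.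

Local Notation e := (@symbol_elt K m S x y).
Local Notation coo := (@symbol_coord K m S x y).

(** The degree of any splitting is n, by counting dimensions, and its trace
    kills all monomials but 1. Thus the reduced trace is n times the
    coefficient of 1, whatever the splitting. *)
Lemma mxtrace_splitting (L : fieldType) (iota : {rmorphism K -> L}) d
    (phi : {rmorphism S -> 'M[L]_d}) z :
  splitting iota phi -> \tr (phi z) = iota (n%:R * coo z 0).
Proof.
case=> phiZ phiB.
have dn : d = m.+1.
  have := size_basis (phiB : basis_of fullv (map_tuple phi (vbasis {:S}))).
  rewrite dimvf (dim_symbol w_prim a0 b0 xn yn yx gen_xy) dim_matrix -[(d *
    d)%R]/(d * d)%N mulnn.
  by move/eqP; rewrite eqn_exp2r // => /eqP.
move: phi phiZ phiB; rewrite dn => phi phiZ _.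
have phi_root (t : S) c : t ^+ n = c%:A -> phi t ^+ n = (iota c)%:A.
  by move=> tn; rewrite -rmorphXn /= tn phiZ rmorph1.
have phi_yx : phi y * phi x = iota w *: (phi x * phi y).
  by rewrite -!rmorphM yx phiZ.
have phi_e p : phi (e p) = symbol_elt (phi x) (phi y) p.
  by rewrite /symbol_elt /symbol_mon rmorphM !rmorphXn.
have iw_prim : n.-primitive_root (iota w) by rewrite fmorph_primitive_root.
rewrite -[in LHS](symbol_coordK w_prim a0 b0 xn yn yx gen_xy z) /symbol_comb.
rewrite !raddf_sum /= (bigD1 (0 : 'I_n * 'I_n)) //= big1 => [|p /negPf p0].
  rewrite phiZ mxtraceZ phi_e.
  rewrite (mxtrace_symbol_elt iw_prim _ _ (phi_root _ _ xn) (phi_root _ _ yn)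
    phi_yx) ?fmorph_eq0 //.
  by rewrite eqxx mulr1n addr0 rmorphM rmorph_nat mulrC.
rewrite phiZ mxtraceZ phi_e.
rewrite (mxtrace_symbol_elt iw_prim _ _ (phi_root _ _ xn) (phi_root _ _ yn)
  phi_yx) ?fmorph_eq0 //.
by rewrite p0 mulr0n mulr0.
Qed.

(** Sending x and y to clock and shift matrices over an extension with an
    n-th root of a respects the relations, hence the products of monomials.
    The image of the monomial basis is again a family of n^2 independent
    monomials. *)
Lemma symbol_splitting : exists (L : fieldType) (iota : {rmorphism K -> L})
    (phi : {rmorphism S -> 'M[L]_n}), splitting iota phi.
Proof.
have [L [iota [z]]] : exists (L : fieldType) (iota : {rmorphism K ->
  L}) (z : L),
    root (map_poly iota ('X^n - a%:P)) z.
  by apply: root_extension; rewrite size_XnsubC.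
rewrite rmorphB /= map_polyXn map_polyC /= rootE !hornerE subr_eq0 => /eqP zn.
have iw_prim : n.-primitive_root (iota w) by rewrite fmorph_primitive_root.
have [X [Y [Xn Yn YX]]] := clock_shift (iota b) z (prim_expr_order iw_prim).
rewrite zn in Xn.
have [ia0 ib0] : iota a != 0 /\ iota b != 0 by rewrite !fmorph_eq0.
pose E := @symbol_elt L m _ X Y.
pose phi (t : S) : 'M[L]_n := \sum_p iota (coo t p) *: E p.
have phiB : zmod_morphism phi.
  move=> u v; rewrite /phi -sumrB; apply: eq_bigr => p _.
  by rewrite !ffunE raddfB rmorphB scalerBl.
have phiZ c t : phi (c *: t) = iota c *: phi t.
  rewrite /phi scaler_sumr; apply: eq_bigr => p _.
  by rewrite !ffunE linearZ rmorphM scalerA.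
have phi0 : phi 0 = 0 by rewrite -(subrr 0) phiB subrr.
have phiD u v : phi (u + v) = phi u + phi v.
  by rewrite -{1}[v]opprK -[- v]add0r 2!phiB phi0 add0r opprK.
have phi_sum := big_morph phi phiD phi0.
have coo_e := symbol_coord_elt w_prim a0 b0 xn yn yx.
have phi_e p : phi (e p) = E p.
  rewrite /phi (bigD1 p) //= big1 => [|q qp]; rewrite coo_e.
    by rewrite eqxx rmorph1 scale1r addr0.
  by rewrite eq_sym (negPf qp) rmorph0 scale0r.
have phi_mon i j : phi (symbol_mon x y i j) = symbol_mon X Y i j.
  have ltn_n k : (k %% n < n)%N by rewrite ltn_mod.
  rewrite (symbol_mon_mod xn yn) (symbol_mon_mod Xn Yn) phiZ.
  by rewrite (phi_e (Ordinal (ltn_n i), Ordinal (ltn_n j))) rmorphM !rmorphXn.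
have phiM : monoid_morphism phi.
  split=> [|u v]; first by have := phi_mon 0%N 0%N;
    rewrite /symbol_mon !expr0 !mulr1.
  (* By bilinearity it is enough to multiply monomials. *)
  pose sc := symbol_coordK w_prim a0 b0 xn yn yx gen_xy.
  rewrite -{1}(sc u) -{1}(sc v) /symbol_comb big_distrlr /= phi_sum.
  rewrite [in RHS]/phi [RHS]big_distrlr /=; apply: eq_bigr => p _.
  rewrite phi_sum; apply: eq_bigr => q _.
  rewrite -!scalerAl -!scalerAr !phiZ (symbol_monM yx) phiZ phi_mon.
  by rewrite rmorphXn -(symbol_monM YX).
pose Phi : {rmorphism S -> 'M[L]_n} :=
  HB.pack phi (GRing.isZmodMorphism.Build _ _ phi phiB)
              (GRing.isMonoidMorphism.Build _ _ phi phiM).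
exists L, iota, Phi; split=> //.
rewrite basisEdim; apply/andP; split; last first.
  rewrite size_map size_tuple [X in (X <= _)%N](dim_symbol w_prim a0 b0 xn yn
    yx gen_xy).
  by rewrite dimvf dim_matrix -mulnn leqnn.
have /span_basis <- : basis_of fullv (@symbol_basis L m _ X Y).
  rewrite basisEfree (symbol_basis_free iw_prim ia0 ib0 Xn Yn YX) subvf
    size_tuple.
  by rewrite dimvf dim_matrix card_prod !card_ord leqnn.
apply/span_subvP => _ /mapP[p _ ->]; rewrite -/(E p) -phi_e.
rewrite (coord_vbasis (memvf (e p))) phi_sum memv_suml // => i _.
rewrite phiZ memvZ // memv_span // -/(Phi _) map_f // mem_nth // size_tuple.
exact: ltn_ord.
Qed.

Lemma reduced_trace_symbol z : reduced_trace z = n%:R * coo z 0.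
Proof.
apply: classical_sets.xget_unique => [|t].
  have [L [iota [phi sphi]]] := symbol_splitting.
  by exists L, iota, n, phi; split=> //; rewrite (mxtrace_splitting z sphi).
case=> L [iota [d [phi [sphi tz]]]]; apply: (fmorph_inj iota).
by rewrite tz (mxtrace_splitting z sphi).
Qed.

End ReducedTrace.

(** * The trace form and its symmetric powers *)

Section Involution.
Variables (I : finType) (sigma : I -> I) (o : I).
Hypothesis sigmaK : involutive sigma.
Hypothesis sigma_fix : forall p, (sigma p == p) = (p == o).

(** Chooses one element in each orbit of size 2 of the involution. *)
Definition first_of_pair (p : I) := (enum_rank p < enum_rank (sigma p))%N.

Lemma first_of_pairP p :
  first_of_pair (sigma p) = (p != o) && ~~ first_of_pair p.
Proof.
rewrite /first_of_pair sigmaK -leqNgt ltn_neqAle -sigma_fix.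
by congr (~~ _ && _); apply: (inj_eq enum_rank_inj).
Qed.

Lemma sum_pairs (R : nmodType) (F : I -> R) :
  \sum_p F p = F o + \sum_(p | first_of_pair p) (F p + F (sigma p)).
Proof.
rewrite (bigD1 o) //= (bigID first_of_pair) /= big_split /=;
  congr (_ + (_ + _)).
  apply: eq_bigl => p; case fp: (first_of_pair p); rewrite ?andbF // andbT.
  by rewrite -sigma_fix; apply: contraTneq fp => sp;
    rewrite /first_of_pair sp ltnn.
rewrite [RHS](reindex_inj (inv_inj sigmaK)) /=; apply: eq_big => p.
  by rewrite first_of_pairP.
by rewrite sigmaK.
Qed.

Definition pair_signs (R : pzRingType) (d : R) (p : I) : R :=
  if p == o then d else if first_of_pair p then 1 else -1.

Let sigma_o : sigma o = o.
Proof. by apply/eqP; rewrite sigma_fix. Qed.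

Let first_neq_o p : first_of_pair p -> (p == o) = false.
Proof. by move=> fp; apply: contraTF fp => /eqP->;
  rewrite /first_of_pair sigma_o ltnn. Qed.

Lemma sum_pair_signs (R : pzRingType) (d : R) : \sum_p pair_signs d p = d.
Proof.
rewrite sum_pairs {1}/pair_signs eqxx big1 ?addr0 // => p fp.
rewrite /pair_signs fp (first_neq_o fp) -sigma_fix sigmaK eq_sym sigma_fix
  (first_neq_o fp).
by rewrite first_of_pairP fp andbF subrr.
Qed.

(** On a pair p, q = sigma p the form is 2 u v_p v_q, which is the difference
    of the squares of u v_p + v_q / 2 and u v_p - v_q / 2. *)
Lemma isometric_pairs (K : fieldType) (u : I -> K) (d s : K) :
  2%:R != 0 :> K -> (forall p, u p != 0) -> (forall p, u (sigma p) = u p) ->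
  u o = d * s ^+ 2 ->
  isometric (fun v : {ffun I -> K^o} => \sum_p u p * ((v p : K) * v (sigma p)))
            (diag_form (pair_signs d)).
Proof.
move=> char2 u0 us uo.
have s0 : s != 0 by apply: contraNneq (u0 o) => s0; rewrite uo s0 expr0n mulr0.
have sneq p : first_of_pair p -> (sigma p == o) = false.
  by move=> fp; rewrite -sigma_fix sigmaK eq_sym sigma_fix first_neq_o.
have sfirst p : first_of_pair p -> first_of_pair (sigma p) = false.
  by move=> fp; rewrite first_of_pairP fp andbF.
pose f (v : {ffun I -> K^o}) : {ffun I -> K^o} := [ffun p =>
  if p == o then s * (v p : K)
  else if first_of_pair p then u p * (v p : K) + (v (sigma p) : K) / 2%:R
  else u p * (v (sigma p) : K) - (v p : K) / 2%:R].
pose g (v : {ffun I -> K^o}) : {ffun I -> K^o} := [ffun p =>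
  if p == o then s^-1 * (v p : K)
  else if first_of_pair p then ((v p : K) + (v (sigma p) : K)) / (2%:R * u p)
  else (v (sigma p) : K) - (v p : K)].
have trichotomy p : [\/ p = o, first_of_pair p |
    exists2 q, first_of_pair q & p = sigma q].
  have [->|po] := eqVneq p o; first exact: Or31.
  have [fp|nfp] := boolP (first_of_pair p); first exact: Or32.
  by apply: Or33; exists (sigma p); rewrite ?sigmaK // first_of_pairP po.
apply: (isometric_intro (f := f) (g := g)).
- move=> c v v'; apply/ffunP => p; rewrite !ffunE /GRing.scale /=.
  by case: ifP => _; [|case: ifP => _]; ring.
- move=> v; apply/ffunP => p; case: (trichotomy p) => [->|fp|[q fq ->]].
  + by rewrite !ffunE eqxx mulrA mulVf ?mul1r.
  + rewrite !ffunE !(first_neq_o fp) fp (sneq _ fp) (sfirst _ fp) sigmaK us.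
    by field; rewrite ?char2 ?u0.
  + rewrite !ffunE !(sneq _ fq) (sfirst _ fq) sigmaK (first_neq_o fq) fq us.
    by field; rewrite ?char2 ?u0.
- move=> v; apply/ffunP => p; case: (trichotomy p) => [->|fp|[q fq ->]].
  + by rewrite !ffunE eqxx mulrA divff ?mul1r.
  + rewrite !ffunE !(first_neq_o fp) fp (sneq _ fp) (sfirst _ fp) sigmaK.
    by field; rewrite ?char2 ?u0.
  + rewrite !ffunE !(sneq _ fq) (sfirst _ fq) sigmaK (first_neq_o fq) fq us.
    by field; rewrite ?char2 ?u0.
- move=> v; rewrite /diag_form !sum_pairs; congr (_ + _).
    by rewrite /pair_signs eqxx ffunE eqxx sigma_o uo; ring.
  apply: eq_bigr => p fp; rewrite /pair_signs !ffunE.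
  rewrite !(first_neq_o fp) fp (sneq _ fp) (sfirst _ fp) sigmaK us.
  by field; rewrite ?char2 ?u0.
Qed.

End Involution.

Section TraceForm.
Variables (K : fieldType) (m : nat) (w a b : K).
Let n := m.+1.
Hypothesis n_odd : odd n.
Hypothesis w_prim : n.-primitive_root w.
Hypotheses (a0 : a != 0) (b0 : b != 0).
Variables (S : falgType K) (x y : S).
Hypotheses (xn : x ^+ n = a%:A) (yn : y ^+ n = b%:A).
Hypothesis yx : y * x = w *: (x * y).
Hypothesis gen_xy : <<<<[:: x; y]>>%VS>>%AS = fullv :> {vspace S}.
Hypothesis char2 : 2%:R != 0 :> K.

Local Notation e := (@symbol_elt K m S x y).
Local Notation coo := (@symbol_coord K m S x y).

(** The structure constants of the monomial basis, whose indices are added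
    modulo n. *)
Let cocycle (p q : 'I_n * 'I_n) : K :=
  w ^+ (q.1 * p.2) * (a ^+ ((p.1 + q.1) %/ n)%N * b ^+ ((p.2 + q.2) %/ n)%N).

Lemma symbol_eltM p q : e p * e q = cocycle p q *: e (p + q).
Proof. by rewrite (symbol_monM yx) (symbol_mon_mod xn yn) scalerA. Qed.

Lemma trace_form_comb v : trace_form S (symbol_comb x y v) =
  \sum_p n%:R * cocycle p (- p) * ((v p : K) * v (- p)).
Proof.
rewrite /trace_form (reduced_trace_symbol w_prim a0 b0 xn yn yx gen_xy).
have coo_e r : coord (symbol_basis m x y) (enum_rank (0 : 'I_n * 'I_n)) (e r) =
  (r == 0)%:R.
  by have := symbol_coord_elt w_prim a0 b0 xn yn yx r 0; rewrite ffunE.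
have term p q : coord (symbol_basis m x y) (enum_rank (0 : 'I_n * 'I_n))
    (((v p : K) *: e p) * ((v q : K) *: e q)) =
    cocycle p q * ((v p : K) * (v q : K)) * (p + q == 0)%:R.
  rewrite -scalerAl -scalerAr symbol_eltM !linearZ /= coo_e.
  by rewrite /GRing.scale /=; ring.
rewrite expr2 {1 2}/symbol_comb big_distrlr /= ffunE linear_sum mulr_sumr.
apply: eq_bigr => p _; rewrite linear_sum (bigD1 (- p)) //= big1 => [|q qp].
  by rewrite term subrr eqxx mulr1 addr0 -!mulrA.
by rewrite term addrC addr_eq0 (negPf qp) mulr0.
Qed.

Lemma cocycle_neq0 p q : cocycle p q != 0.
Proof. by rewrite /cocycle !mulf_neq0 ?expf_neq0 ?(prim_root_neq0 w_prim). Qed.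

Lemma cocycle_opp p : cocycle (- p) p = cocycle p (- p).
Proof.
rewrite /cocycle !(addnC (- p).1) !(addnC (- p).2); congr (_ * _).
have w0 := prim_root_neq0 w_prim.
have inv (i : 'I_n) : ((- i)%R + i = 0 %[mod n])%N.
  by have /(congr1 val) := addNr i.
have wD i j : (i = 0 %[mod n])%N -> w ^+ (i * j) = 1.
  by move=> i0; rewrite exprM -(prim_expr_mod w_prim) i0 mod0n expr1n.
apply: (mulfI (expf_neq0 (p.1 * p.2) w0)); rewrite -!exprD.
rewrite -mulnDl -mulnDr (mulnC p.1) !wD //; rewrite addnC; exact: inv.
Qed.

Lemma opp_fix (p : 'I_n * 'I_n) : (- p == p) = (p == 0).
Proof.
have fix0 (i : 'I_n) : (- i == i) = (i == 0).
  apply/eqP/eqP => [/(congr1 val)/= |->]; last by rewrite oppr0.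
  move=> ii; apply/val_inj => /=; move: ii; have := ltn_ord i.
  case: (posnP i) => [//|i_gt0 _]; rewrite modn_small ?ltn_subrL ?i_gt0 //.
  by move: n_odd; rewrite /n; lia.
apply/idP/idP => [/eqP pp|/eqP->]; last by rewrite oppr0.
have /eqP := congr1 fst pp; have /eqP := congr1 snd pp.
by case: p {pp} => p1 p2; rewrite /= !fix0 => /eqP-> /eqP->.
Qed.

(** The monomials are indexed by pairs of integers modulo n, and the
    involution is the opposite; as n is odd its only fixed point is 0. *)
Lemma isometric_trace_form (d : int) s :
  n%:R = d%:~R * s ^+ 2 :> K -> d ^+ 2 = 1 ->
  isometric (trace_form S)
    (diag_form (tnth (in_tuple (hyp_signs K ((n ^ 2 - 1)./2) ++ [:: d%:~R])))).
Proof.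
move=> ns d2.
pose u p := n%:R * cocycle p (- p).
pose I : finType := ('I_n * 'I_n)%type.
pose q (v : {ffun I -> K^o}) := \sum_p u p * ((v p : K) * v (- p)).
have H1 : isometric q (trace_form S).
  apply: (isometric_intro (f := @symbol_comb K m S x y) (g := coo)).
  - exact: symbol_comb_linear.
  - exact (symbol_combK w_prim a0 b0 xn yn yx gen_xy).
  - exact (symbol_coordK w_prim a0 b0 xn yn yx gen_xy).
  - exact: trace_form_comb.
have H2 : isometric q
    (diag_form (pair_signs (fun p : I => - p) 0 (d%:~R : K))).
  apply: (@isometric_pairs I (fun p => - p) 0 (@opprK _) opp_fix K u d%:~R s)
    => //.
  - by move=> p; rewrite mulf_neq0 ?cocycle_neq0 // (prim_root_natf_neq0
    w_prim).
  - by move=> p; rewrite /u opprK cocycle_opp.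
  - by rewrite /u /cocycle oppr0 /= mul0n addn0 div0n !expr0 !mulr1.
apply: isometric_trans (isometric_sym H1) _; apply: isometric_trans H2 _.
pose c := pair_signs (fun p : I => - p) 0 d.
have c1 : all (fun z => z ^+ 2 == 1) (codom c).
  apply/allP => _ /codomP[p ->]; rewrite /c /pair_signs.
  by case: ifP => _; [rewrite d2|case: ifP].
have cs : \sum_(z <- codom c) z = d *+ 1.
  by rewrite codomE big_map big_enum /= (@sum_pair_signs I (fun p =>
    - p) 0 (@opprK _) opp_fix).
have [h [hsz hP]] := signs_normal_form d2 c1 cs.
(* The number of hyperbolic planes follows from the dimension. *)
have Dh : h = (n ^ 2 - 1)./2.
  by move: hsz; rewrite size_codom card_prod !card_ord -/n mulnn; lia.
apply: isometric_perm; rewrite codom_in_tuple -Dh.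
have -> : codom (pair_signs (fun p : I => - p) 0 (d%:~R : K)) =
    map intr (codom c).
  rewrite !codomE -[RHS]map_comp; apply: eq_map => p; rewrite /= /c /pair_signs.
  by case: ifP => _ //; case: ifP => _; rewrite ?rmorphN rmorph1.
apply: perm_trans (perm_map _ hP) _; rewrite map_cat /= perm_sym -cat1s
  perm_catC.
by rewrite perm_cat2l map_flatten map_nseq.
Qed.

End TraceForm.

Theorem proposition4p2 (n : nat) (K : fieldType) (omega a b : K)
    (S : falgType K) (k : nat) :
  odd n ->
  2%N \notin [pchar K] ->
  n.-primitive_root omega ->
  a != 0 -> b != 0 ->
  is_symbol_algebra n omega a b S ->
  (odd k ->
   exists h : nat,
     ('C((n ^ 2 + k - 2)./2, (k - 1)./2) + 2 * h = 'C(n ^ 2 + k - 1, k))%N /\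
     isometric (sym_power k (trace_form S))
       (perp
          (copies 'C((n ^ 2 + k - 2)./2, (k - 1)./2)%N
             (unary_form ((-1) ^+ ((n - 1)./2)%N : K)))
          (copies h (hyperbolic_plane K)))) /\
  (~~ odd k ->
   exists h : nat,
     ('C((n ^ 2 + k - 1)./2, k./2) + 2 * h = 'C(n ^ 2 + k - 1, k))%N /\
     isometric (sym_power k (trace_form S))
       (perp
          (copies 'C((n ^ 2 + k - 1)./2, k./2)%N (unary_form (1 : K)))
          (copies h (hyperbolic_plane K)))).
Proof.
case: n => // m n_odd char2' w_prim a0 b0 [x [y [xn yn yx gen_xy]]].
have char2 : 2%:R != 0 :> K.
  by apply: contraNneq char2' => K2; apply/andP; split=> //; apply/eqP.
have [s ns] := natr_prim_root_sqr n_odd w_prim.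
pose d : int := (-1) ^+ (m.+1 - 1)./2.
have d2 : d ^+ 2 = 1 by rewrite /d sqrr_sign.
have dK : d%:~R = (-1) ^+ (m.+1 - 1)./2 :> K by rewrite rmorphXn rmorphN1.
have n2 : (m.+1 ^ 2 = ((m.+1 ^ 2 - 1)./2).*2.+1)%N.
  have: odd (m.+1 ^ 2) by rewrite oddX n_odd orbT.
  by move: (m.+1 ^ 2)%N => N; lia.
pose p := ((m.+1 ^ 2 - 1)./2).
pose s0 := hyp_signs K p ++ [:: (d%:~R : K)].
have s0_neq0 i : tnth (in_tuple s0) i != 0.
  have : tnth (in_tuple s0) i \in s0 by apply: mem_tnth.
  rewrite mem_cat inE => /orP[/flattenP[t]|/eqP->].
    by rewrite mem_nseq => /andP[_ /eqP->]; rewrite !inE => /orP[]/eqP->;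
      rewrite ?oppr_eq0 oner_eq0.
  by rewrite dK signr_eq0.
have T0 : isometric (trace_form S) (diag_form (tnth (in_tuple s0))).
  have ns' : m.+1%:R = d%:~R * s ^+ 2 :> K by rewrite ns dK.
  exact: (isometric_trace_form n_odd w_prim a0 b0 xn yn yx gen_xy char2 ns').
have sym : isometric (sym_power k (trace_form S))
    (diag_form (tnth (in_tuple (symseq s0 k)))).
  apply: (isometric_sym_power char2 s0_neq0 T0).
    rewrite (dim_symbol w_prim a0 b0 xn yn yx gen_xy) card_ord.
    by rewrite size_cat size_flatten /shape map_nseq sumn_nseq /=; rewrite /p;
      lia.
  by rewrite !codom_in_tuple.
have [h [hC hI]] := isometric_symseq_signs K p k d2.
have main := isometric_trans sym hI.
split=> k_odd; exists h.
  have Dk : k = k./2.*2.+1 by rewrite -[LHS]odd_double_half k_odd.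
  have -> : 'C((m.+1 ^ 2 + k - 2)./2, (k - 1)./2) = 'C(p + k./2, k./2).
    by congr 'C(_, _); move: n2; rewrite /p; lia.
  have dkd : (d ^+ k)%:~R = (-1) ^+ (m.+1 - 1)./2 :> K.
    by rewrite Dk exprS -muln2 mulnC exprM d2 expr1n mulr1.
  by rewrite -dkd; split=> //; rewrite hC {1}n2.
have Dk : k = k./2.*2 by rewrite -[LHS]odd_double_half (negPf k_odd).
have -> : 'C((m.+1 ^ 2 + k - 1)./2, k./2) = 'C(p + k./2, k./2).
  by congr 'C(_, _); move: n2; rewrite /p; lia.
have dk1 : (d ^+ k)%:~R = 1 :> K by rewrite Dk -muln2 mulnC exprM d2 expr1n.
by rewrite -{1}dk1; split=> //; rewrite hC {1}n2.
Qed.
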